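(* Let $p>2$ and let $\Omega\subset\mathbb{R}^n$ be a bounded domain of class $C^{2+\alpha}$. There exists $u_0\in X$ such that $\mathcal{L}(u_0)=\partial\Omega$ and such that, moreover, the global viscosity solution $u$ of (P) with initial data $u_0$ satisfies $$u(x,t_0)\ge c_0\quad\text{for all } x\in\partial\Omega,$$ for some $t_0>0$ and $c_0>0$. Furthermore, the same remains true for any $v_0\in X$ with $v_0\ge u_0$ (that is, $\mathcal{L}(v_0)=\partial\Omega$, and the global viscosity solution $v$ of (P) with initial data $v_0$ satisfies $v(x,t_0)\ge c_0$ for all $x\in\partial\Omega$, for some $t_0,c_0>0$).
   Context: Problem (P) is the initial-boundary value problem $u_t-\Delta u=|\nabla u|^p$ for $x\in\Omega,\ t>0$; $u(x,t)=0$ for $x\in\partial\Omega,\ t>0$; $u(x,0)=u_0(x)$ for $x\in\Omega$. Here $\Omega\subset\mathbb{R}^n$ is a bounded domain of class $C^{2+\alpha}$ (some $\alpha\in(0,1)$), $p>2$, and $u_0\in X:=\{v\in C^1(\overline\Omega):\ v\ge 0 \text{ and } v=0 \text{ on } \partial\Omega\}$, endowed with the $C^1$ norm. Global viscosity solution: for each $u_0\in X$, problem (P) is known [Barles–Da Lio, 2004] to have a unique global viscosity solution $u\in C(\overline\Omega\times[0,\infty))$ with boundary conditions understood in the viscosity sense. That is, $u(\cdot,0)=u_0$ and for every $C^{2,1}$ test function $\phi$: (a) if $u-\phi$ has a local maximum relative to $\overline\Omega\times(0,\infty)$ at $(x,t)$, then at $(x,t)$ one has $\phi_t-\Delta\phi-|\nabla\phi|^p\le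 0$ if $x\in\Omega$, and $\min\{\phi_t-\Delta\phi-|\nabla\phi|^p,\,u\}\le 0$ if $x\in\partial\Omega$; (b) if $u-\phi$ has a local minimum there, then $\phi_t-\Delta\phi-|\nabla\phi|^p\ge 0$ if $x\in\Omega$, and $\max\{\phi_t-\Delta\phi-|\nabla\phi|^p,\,u\}\ge 0$ if $x\in\partial\Omega$. It is known that $u\in C^{2,1}(\Omega\times(0,\infty))$, that it solves the PDE classically in $\Omega\times(0,\infty)$, and that $u(x,t)=\lim_{j\to\infty}u_j(x,t)$ in $\Omega\times(0,\infty)$, where $u_j$ is the global classical solution of the same problem with $|\nabla u|^p$ replaced by $F_j(\nabla u)$, $F_j(\xi)=\min(|\xi|^p,j^{p-2}|\xi|^2)$. The boundary condition $u=0$ need not hold in the classical sense for all times. Loss of boundary conditions set: for $u_0\in X$ with global viscosity solution $u$, $\mathcal{L}(u_0)=\{x_0\in\partial\Omega:\ u(x_0,t)>0\text{ for some }t>0\}$. *)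

(* Defs.v *)
(* R^n is 'rV[R]_n: its topology is the usual one, but `|_| and ball refer to
   the sup norm, hence the explicit Euclidean norm of gradients below. *)
From HB Require Import structures.
From mathcomp Require Import all_boot all_order all_algebra.
From mathcomp Require Import all_classical all_reals all_analysis.

Set Implicit Arguments.
Unset Strict Implicit.
Unset Printing Implicit Defensive.

Import Order.TTheory GRing.Theory Num.Theory.
Import numFieldNormedType.Exports.

Local Open Scope classical_set_scope.
Local Open Scope ring_scope.

Section Calculus.
Context {R : realType} {n : nat}.
Implicit Types (i j : 'I_n) (f : 'rV[R]_n -> R) (x : 'rV[R]_n).

Definition e_ i : 'rV[R]_n := delta_mx 0 i.

Definition partial i f x : R := 'D_(e_ i) f x.

Definition laplacian f x : R := \sum_(i < n) partial i (partial i f) x.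

Definition euclid_grad f x : R := Num.sqrt (\sum_(i < n) partial i f x ^+ 2).

Definition C2 f : Prop :=
  [/\ continuous f,
      forall i, (forall x, derivable f x (e_ i)) /\ continuous (partial i f)
    & forall i j, (forall x, derivable (partial i f) x (e_ j)) /\
        continuous (partial j (partial i f))].

Definition C2_holder (alpha : R) f : Prop :=
  C2 f /\ exists C : R, forall i j x y,
    `|partial j (partial i f) x - partial j (partial i f) y|
      <= C * `|x - y| `^ alpha.

End Calculus.

Section Domain.
Context {R : realType} {n : nat}.
Implicit Types Omega : set 'rV[R]_n.

Definition boundary Omega : set 'rV[R]_n := closure Omega `\` interior Omega.

Definition bounded_domain Omega : Prop :=
  [/\ Omega !=set0, open Omega, connected Omega & bounded_set Omega].

(* Near each boundary point, and up to renumbering and reorienting the axes,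
   Omega lies above the graph of a C^{2,alpha} function of the n - 1 other
   coordinates: gamma is a function on R^n that does not depend on the i-th
   coordinate.  Asking gamma to be defined and regular on the whole space is no
   restriction, since it can be cut off away from the ball. *)
Definition class_C2alpha (alpha : R) Omega : Prop :=
  forall x0, boundary Omega x0 ->
    exists (r : R) (i : 'I_n) (s : bool) (gamma : 'rV[R]_n -> R),
      [/\ 0 < r,
          C2_holder alpha gamma,
          forall x (h : R), gamma (x + h *: e_ i) = gamma x
        & forall x, ball x0 r x ->
            (Omega x <-> gamma x < (-1) ^+ s * x 0 i)].

(* C^1(closure Omega): C^1 in Omega, the function and its first derivatives
   extending continuously to the closure.  The values of v outside the closure
   are irrelevant. *)
Definition C1_closure Omega (v : 'rV[R]_n -> R) : Prop :=
  {within closure Omega, continuous v} /\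
  forall i : 'I_n, exists g : 'rV[R]_n -> R,
    {within closure Omega, continuous g} /\
    forall x, Omega x -> derivable v x (e_ i) /\ partial i v x = g x.

(* The space X of initial data. *)
Definition initial_data Omega : set ('rV[R]_n -> R) :=
  [set v | [/\ C1_closure Omega v,
               forall x, closure Omega x -> 0 <= v x
             & forall x, boundary Omega x -> v x = 0]].

End Domain.

Section Viscosity.
Context {R : realType} {n : nat}.
Implicit Types (Omega : set 'rV[R]_n) (phi u : 'rV[R]_n -> R -> R).

Definition d_t phi (x : 'rV[R]_n) (t : R) : R := derive1 (phi x) t.

Definition d_x (i : 'I_n) phi (x : 'rV[R]_n) (t : R) : R :=
  partial i (phi ^~ t) x.

Definition jointly_continuous_at phi (x : 'rV[R]_n) (t : R) : Prop :=
  {for (x, t), continuous (fun z : 'rV[R]_n * R => phi z.1 z.2)}.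

(* C^{2,1}(R^n x (0, oo)). *)
Definition C21 phi : Prop :=
  forall x t, 0 < t ->
    [/\ jointly_continuous_at phi x t,
        derivable (phi x) t 1 /\ jointly_continuous_at (d_t phi) x t,
        forall i, derivable (phi ^~ t) x (e_ i) /\
          jointly_continuous_at (d_x i phi) x t
      & forall i j, derivable (d_x i phi ^~ t) x (e_ j) /\
          jointly_continuous_at (d_x j (d_x i phi)) x t].

Definition vhj (p : R) phi (x : 'rV[R]_n) (t : R) : R :=
  d_t phi x t - laplacian (phi ^~ t) x - euclid_grad (phi ^~ t) x `^ p.

Definition local_max_rel (D : set ('rV[R]_n * R)) (f : 'rV[R]_n -> R -> R)
    (x : 'rV[R]_n) (t : R) : Prop :=
  \forall z \near within D (nbhs (x, t)), f z.1 z.2 <= f x t.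

Definition local_min_rel (D : set ('rV[R]_n * R)) (f : 'rV[R]_n -> R -> R)
    (x : 'rV[R]_n) (t : R) : Prop :=
  \forall z \near within D (nbhs (x, t)), f x t <= f z.1 z.2.

(* Only the values of u on closure Omega x [0, oo) matter. *)
Definition global_viscosity_solution Omega (p : R) (u0 : 'rV[R]_n -> R) u
    : Prop :=
  let D := closure Omega `*` [set t : R | 0 < t] in
  [/\ {within closure Omega `*` [set t : R | 0 <= t],
         continuous (fun z : 'rV[R]_n * R => u z.1 z.2)},
      forall x, closure Omega x -> u x 0 = u0 x
    & forall phi, C21 phi -> forall x t, closure Omega x -> 0 < t ->
        (local_max_rel D (fun y s => u y s - phi y s) x t ->
           (Omega x -> vhj p phi x t <= 0) /\
           (boundary Omega x -> Num.min (vhj p phi x t) (u x t) <= 0)) /\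
        (local_min_rel D (fun y s => u y s - phi y s) x t ->
           (Omega x -> 0 <= vhj p phi x t) /\
           (boundary Omega x -> 0 <= Num.max (vhj p phi x t) (u x t)))].

(* The set L(u0), where u is the global viscosity solution with data u0. *)
Definition loss_set Omega u : set 'rV[R]_n :=
  [set x0 | boundary Omega x0 /\ exists t : R, 0 < t /\ 0 < u x0 t].

End Viscosity.

(* Main.v *)
Require Import Defs.
From HB Require Import structures.
From mathcomp Require Import all_boot all_order all_algebra.
From mathcomp Require Import all_classical all_reals all_analysis.
From mathcomp Require Import ring lra.
From mathcomp Require finmap.
Import Order.TTheory GRing.Theory Num.Theory.
Import numFieldNormedType.Exports.
Local Open Scope classical_set_scope.
Local Open Scope ring_scope.

(* Everything follows from comparing a viscosity solution u >= 0 with smooth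
   strict subsolutions phi(x, t) = a(x) + b(t) that lie below u at the initial
   and final times and are nonpositive on the boundary of Omega.
   If u(., 0) is a large multiple N eta of a C^2 function eta vanishing on the
   boundary, then N (eta - C t) <= u, so u >= N / 2 on {eta >= 1} up to a time
   that does not depend on N.  Near a boundary point x0, let h be the height
   above the boundary and take
     a(x) = G(h(x)) - B |x - x0|^2,
     G(s) = A z^beta - c / z,   z = s + sqrt(s^2 + eps^2),
   with beta = (p - 2) / (p - 1).  The term c / z is a boundary layer of width
   eps, which makes phi <= 0 at h = 0 although phi is bounded below by a
   positive constant at distance eps from the boundary.  The function G is a
   subsolution because -G'' <= 2 G' / w and G' >= beta A w^(beta - 1), with
   w = sqrt(s^2 + eps^2), give -G'' <= const * A^(1 - p) G'^p : the layer costs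
   nothing, and since beta > 0 (that is, p > 2) G stays bounded as eps -> 0.
   Letting eps -> 0 bounds u from below near x0, hence at x0 by continuity; the
   boundary is compact. *)

Set Implicit Arguments.
Unset Strict Implicit.
Unset Printing Implicit Defensive.

(** * Functions of class C^2 with explicit derivatives *)

Section Continuity.
Context {R : realType} {T : topologicalType}.
Implicit Types (f g : T -> R).

Lemma continuous_add f g : continuous f -> continuous g ->
  continuous (fun x => f x + g x).
Proof. by move=> cf cg x; exact: continuousD (cf x) (cg x). Qed.

Lemma continuous_sub f g : continuous f -> continuous g ->
  continuous (fun x => f x - g x).
Proof. by move=> cf cg x; exact: continuousB (cf x) (cg x). Qed.

Lemma continuous_mul f g : continuous f -> continuous g ->
  continuous (fun x => f x * g x).
Proof. by move=> cf cg x; exact: continuousM (cf x) (cg x). Qed.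

Lemma continuous_scale (c : R) f : continuous f ->
  continuous (fun x => c * f x).
Proof. exact: continuous_mul (@cst_continuous _ _ c). Qed.

Lemma continuous_comp1 (G : R -> R) f : continuous G -> continuous f ->
  continuous (fun x => G (f x)).
Proof. by move=> cG cf x; exact: continuous_comp (cf x) (cG _). Qed.

Lemma continuous_bigsum m (F : 'I_m -> T -> R) :
  (forall k, continuous (F k)) -> continuous (fun x => \sum_(k < m) F k x).
Proof.
move=> cF; have -> : (fun x => \sum_(k < m) F k x) = \sum_(k < m) F k.
  by apply/funext => y; rewrite fct_sumE.
apply: (big_ind (fun g : T -> R => continuous g)) => //.
  exact: cst_continuous.
by move=> f g; exact: continuous_add.
Qed.

End Continuity.

Section Calculus.
Context {R : realType} {n : nat}.
Implicit Types (f g : 'rV[R]_n -> R) (x v : 'rV[R]_n).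

(** Restriction to a line turns a directional derivative into a derivative in one real variable, to
    which the one-variable chain rule applies. *)
Lemma is_derive_line f x v (a : R) :
  is_derive x v f a <->
  is_derive (0 : R) (1 : R) (fun t : R => f (t *: v + x)) a.
Proof.
have E : 'D_1 (fun t : R => f (t *: v + x)) 0 = 'D_v f x.
  rewrite /derive; set F := (X in lim (X @ _)); set H := (X in _ = lim (X @ _)).
  suff -> : F = H by [].
  by apply/funext => t; rewrite /F /H /= addr0 scale0r add0r [_ *: 1]mulr1.
split=> -[d e]; split.
- exact: (derivable1P f x v).1 d.
- by rewrite E.
- exact: (derivable1P f x v).2 d.
- by rewrite -E.
Qed.

Lemma is_derive_comp1 (G : R -> R) f x v (a b : R) :
  is_derive (f x) (1 : R) G b -> is_derive x v f a ->
  is_derive x v (fun y => G (f y)) (b * a).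
Proof.
move=> dG /is_derive_line df; apply/is_derive_line.
by apply: (@is_derive1_comp _ G (fun t : R => f (t *: v + x)));
  rewrite // scale0r add0r.
Qed.

(* Carries the derivatives explicitly, so that the operators of Defs can be
   computed on sums, products and compositions. *)
Definition C2_with f (df : 'I_n -> 'rV[R]_n -> R)
    (ddf : 'I_n -> 'I_n -> 'rV[R]_n -> R) : Prop :=
  [/\ continuous f,
      forall i x, is_derive x (e_ i) f (df i x), forall i, continuous (df i),
      forall i j x, is_derive x (e_ j) (df i) (ddf i j x)
    & forall i j, continuous (ddf i j)].

Lemma C2P f : C2 f ->
  C2_with f (fun i => partial i f) (fun i j => partial j (partial i f)).
Proof.
move=> [cf df ddf]; split=> //.
- by move=> i x; apply: derivableP; exact: (df i).1.
- by move=> i; exact: (df i).2.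
- by move=> i j x; apply: derivableP; exact: (ddf i j).1.
- by move=> i j; exact: (ddf i j).2.
Qed.

Section with_derivatives.
Context {f : 'rV[R]_n -> R} {df : 'I_n -> 'rV[R]_n -> R}
  {ddf : 'I_n -> 'I_n -> 'rV[R]_n -> R}.
Hypothesis fC2 : C2_with f df ddf.

Lemma C2_with_partial i : partial i f = df i.
Proof. by case: fC2 => _ h _ _ _; apply/funext => x; have [] := h i x. Qed.

Lemma C2_with_partial2 i j : partial j (partial i f) = ddf i j.
Proof.
rewrite C2_with_partial.
by case: fC2 => _ _ _ h _; apply/funext => x; have [] := h i j x.
Qed.

Lemma C2_with_C2 : C2 f.
Proof.
case: fC2 => cf d cd dd cdd; split=> // [i|i j].
  by rewrite C2_with_partial; split=> // x; have [] := d i x.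
by rewrite C2_with_partial2 C2_with_partial; split=> // x; have [] := dd i j x.
Qed.

Lemma C2_with_laplacian x : laplacian f x = \sum_(i < n) ddf i i x.
Proof. by apply: eq_bigr => i _; rewrite C2_with_partial2. Qed.

Lemma C2_with_grad x : euclid_grad f x = Num.sqrt (\sum_(i < n) df i x ^+ 2).
Proof.
by rewrite /euclid_grad; under eq_bigr do rewrite C2_with_partial.
Qed.

Lemma C2_with_grad_ge i x : `|df i x| <= euclid_grad f x.
Proof.
rewrite C2_with_grad -sqrtr_sqr ler_wsqrtr// (bigD1 i)//= lerDl.
by apply: sumr_ge0 => j _; exact: sqr_ge0.
Qed.

End with_derivatives.

Lemma C2_with_cst (c : R) : C2_with (fun=> c) (fun _ _ => 0) (fun _ _ _ => 0).
Proof.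
by split=> *; (exact: cst_continuous) || (exact: is_derive_cst).
Qed.

Lemma C2_with_coord k : C2_with (fun x => x 0 k)
  (fun i _ => (i == k)%:R) (fun _ _ _ => 0).
Proof.
split=> [|i x|i ? ?|i j x|i j ? ?].
- exact: coord_continuous.
- apply/is_derive_line.
  have -> : (fun t : R => (t *: e_ i + x) 0 k) =
            (fun t : R => (i == k)%:R *: t + x 0 k).
    by apply/funext => t; rewrite !mxE/= [k == i]eq_sym mulrC.
  have := is_deriveD (is_deriveZ (i == k)%:R (is_derive_id (0 : R) (1 : R)))
    (is_derive_cst (x 0 k) (0 : R) (1 : R)).
  by rewrite addr0 [_ *: 1]mulr1.
- exact: cst_continuous.
- exact: is_derive_cst.
- exact: cst_continuous.
Qed.

Lemma C2_withD f g df dg ddf ddg : C2_with f df ddf -> C2_with g dg ddg ->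
  C2_with (fun x => f x + g x) (fun i x => df i x + dg i x)
    (fun i j x => ddf i j x + ddg i j x).
Proof.
move=> [cf f1 cf1 f2 cf2] [cg g1 cg1 g2 cg2]; split.
- exact: continuous_add.
- by move=> i x; exact: is_deriveD (f1 i x) (g1 i x).
- by move=> i; exact: continuous_add.
- by move=> i j x; exact: is_deriveD (f2 i j x) (g2 i j x).
- by move=> i j; exact: continuous_add.
Qed.

Lemma C2_withM f g df dg ddf ddg : C2_with f df ddf -> C2_with g dg ddg ->
  C2_with (fun x => f x * g x) (fun i x => f x * dg i x + g x * df i x)
    (fun i j x => (f x * ddg i j x + dg i x * df j x) +
                  (g x * ddf i j x + df i x * dg j x)).
Proof.
move=> [cf f1 cf1 f2 cf2] [cg g1 cg1 g2 cg2]; split.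
- exact: continuous_mul.
- by move=> i x; exact: is_deriveM (f1 i x) (g1 i x).
- by move=> i; apply: continuous_add; exact: continuous_mul.
- move=> i j x; exact: is_deriveD (is_deriveM (f1 j x) (g2 i j x))
    (is_deriveM (g1 j x) (f2 i j x)).
- by move=> i j; do 2 apply: continuous_add; exact: continuous_mul.
Qed.

Lemma C2_withZ (c : R) f df ddf : C2_with f df ddf ->
  C2_with (fun x => c * f x) (fun i x => c * df i x)
    (fun i j x => c * ddf i j x).
Proof.
move=> [cf f1 cf1 f2 cf2]; split.
- exact: continuous_scale.
- by move=> i x; exact: (@is_deriveZ _ _ _ _ c _ _ _ (f1 i x)).
- by move=> i; exact: continuous_scale.
- by move=> i j x; exact: (@is_deriveZ _ _ _ _ c _ _ _ (f2 i j x)).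
- by move=> i j; exact: continuous_scale.
Qed.

(** Continuity is asked of [G2] alone: [G] and [G1] are differentiable, hence continuous. *)
Definition C2_with1 (G G1 G2 : R -> R) : Prop :=
  [/\ forall s : R, is_derive s (1 : R) G (G1 s), forall s : R,
    is_derive s (1 : R) G1 (G2 s)
    & continuous G2].

Lemma is_derive1_continuous (G G1 : R -> R) :
  (forall s : R, is_derive s (1 : R) G (G1 s)) -> continuous G.
Proof.
by move=> d s; apply/differentiable_continuous/derivable1_diffP; have [] := d s.
Qed.

Lemma C2_with_comp G G1 G2 f df ddf : C2_with1 G G1 G2 -> C2_with f df ddf ->
  C2_with (fun x => G (f x)) (fun i x => G1 (f x) * df i x)
    (fun i j x => G1 (f x) * ddf i j x + df i x * (G2 (f x) * df j x)).
Proof.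
move=> [d1 d2 cG2] [cf f1 cf1 f2 cf2].
have cG := is_derive1_continuous d1.
have cG1 := is_derive1_continuous d2.
split.
- exact: continuous_comp1.
- by move=> i x; exact: is_derive_comp1.
- by move=> i; apply: continuous_mul => //; exact: continuous_comp1.
- move=> i j x.
  exact: is_deriveM (is_derive_comp1 (d2 (f x)) (f1 j x)) (f2 i j x).
- move=> i j; apply: continuous_add; apply: continuous_mul => //.
    exact: continuous_comp1.
  by apply: continuous_mul => //; exact: continuous_comp1.
Qed.

Lemma C2_with_sum m (F : 'I_m -> 'rV[R]_n -> R) dF ddF :
  (forall k, C2_with (F k) (dF k) (ddF k)) ->
  C2_with (fun x => \sum_(k < m) F k x) (fun i x => \sum_(k < m) dF k i x)
    (fun i j x => \sum_(k < m) ddF k i j x).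
Proof.
elim: m F dF ddF => [|m IH] F dF ddF H.
  have -> : (fun x => \sum_(k < 0) F k x) = fun=> 0.
    by apply/funext => x; rewrite big_ord0.
  have -> : (fun i x => \sum_(k < 0) dF k i x) = fun _ _ => 0.
    by do 2 apply/funext => ?; rewrite big_ord0.
  have -> : (fun i j x => \sum_(k < 0) ddF k i j x) = fun _ _ _ => 0.
    by do 3 apply/funext => ?; rewrite big_ord0.
  exact: C2_with_cst.
have -> : (fun x => \sum_(k < m.+1) F k x) =
    fun x => F ord0 x + \sum_(k < m) F (lift ord0 k) x.
  by apply/funext => x; rewrite big_ord_recl.
have -> : (fun i x => \sum_(k < m.+1) dF k i x) =
    fun i x => dF ord0 i x + \sum_(k < m) dF (lift ord0 k) i x.
  by do 2 apply/funext => ?; rewrite big_ord_recl.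
have -> : (fun i j x => \sum_(k < m.+1) ddF k i j x) =
    fun i j x => ddF ord0 i j x + \sum_(k < m) ddF (lift ord0 k) i j x.
  by do 3 apply/funext => ?; rewrite big_ord_recl.
by apply: C2_withD => //; exact: IH.
Qed.

End Calculus.

(** * Comparison with separated test functions *)

Section Comparison.
Context {R : realType} {n : nat}.
Implicit Types (Omega Q : set 'rV[R]_n) (u : 'rV[R]_n -> R -> R).

Section separated_test_function.
Context {a : 'rV[R]_n -> R} {da : 'I_n -> 'rV[R]_n -> R}
  {dda : 'I_n -> 'I_n -> 'rV[R]_n -> R} {b b1 : R -> R}.
Hypotheses (aC2 : C2_with a da dda)
  (db : forall t : R, is_derive t (1 : R) b (b1 t)) (cb1 : continuous b1).

Lemma separated_d_t : d_t (fun x t => a x + b t) = fun _ t => b1 t.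
Proof.
apply/funext => x; apply/funext => t; rewrite /d_t derive1E.
have [_] := is_deriveD (is_derive_cst (a x) t (1 : R)) (db t).
by rewrite add0r.
Qed.

Lemma separated_is_derive i x t : is_derive x (e_ i) (fun y =>
  a y + b t) (da i x).
Proof.
case: aC2 => _ h _ _ _; rewrite -[da i x]addr0.
exact: is_deriveD (h i x) (is_derive_cst _ _ _).
Qed.

Lemma separated_d_x i : d_x i (fun x t => a x + b t) = fun x _ => da i x.
Proof.
apply/funext => x; apply/funext => t.
rewrite /d_x /partial.
by have [_ ->] := separated_is_derive i x t.
Qed.

Lemma continuous_space (f : 'rV[R]_n -> R) : continuous f ->
  continuous (fun z : 'rV[R]_n * R => f z.1).
Proof. move=> cf z; exact: (@continuous_comp _ _ _ fst f z cvg_fst (cf _)). Qed.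

Lemma continuous_time (f : R -> R) : continuous f ->
  continuous (fun z : 'rV[R]_n * R => f z.2).
Proof. move=> cf z; exact: (@continuous_comp _ _ _ snd f z cvg_snd (cf _)). Qed.

Lemma separated_continuous :
  continuous (fun z : 'rV[R]_n * R => a z.1 + b z.2).
Proof.
case: aC2 => ca _ _ _ _; apply: continuous_add; first exact: continuous_space.
exact/continuous_time/(is_derive1_continuous db).
Qed.

Lemma separated_C21 : C21 (fun x t => a x + b t).
Proof.
case: aC2 => ca h ch hh chh x t _; split.
- exact: separated_continuous.
- split; last by rewrite separated_d_t; exact: continuous_time.
  exact: derivableD (derivable_cst _ _ _) (@ex_derive _ _ _ _ _ _ _ (db t)).
- move=> i; split; last by rewrite separated_d_x; exact: continuous_space.
  by have [] := separated_is_derive i x t.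
- move=> i j; rewrite separated_d_x; split; first by have [] := hh i j x.
  have -> : d_x j (fun y _ => da i y) = fun y (_ : R) => dda i j y.
    apply/funext => y; apply/funext => s; rewrite /d_x /partial.
    by have [_ ->] := hh i j y.
  exact: continuous_space.
Qed.

Lemma separated_vhj (p : R) x t : vhj p (fun x t => a x + b t) x t =
  b1 t - laplacian a x - euclid_grad a x `^ p.
Proof.
have E i : partial i (fun y => a y + b t) = partial i a.
  rewrite (C2_with_partial aC2); apply/funext => y; rewrite /partial.
  by have [_ ->] := separated_is_derive i y t.
have El : laplacian (fun y => a y + b t) x = laplacian a x.
  by apply: eq_bigr => i _; rewrite E.
have Eg : euclid_grad (fun y => a y + b t) x = euclid_grad a x.
  by congr Num.sqrt; apply: eq_bigr => i _; rewrite E.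
by rewrite /vhj separated_d_t /= El Eg.
Qed.

(** Minimise [u - (a + b)] over [Q] times [[0, tau]]. At a minimum of the second kind the test
    function is admissible and strictly violates the supersolution inequality, which excludes points
    of [Omega] and leaves [0 <= u] on the boundary. *)
Lemma viscosity_comparison Omega (p : R) (u0 : 'rV[R]_n -> R) u Q (tau : R) :
  global_viscosity_solution Omega p u0 u -> compact Q -> Q `<=` closure Omega ->
  (forall x t, Q x -> 0 <= t <= tau -> a x + b t <= u x t \/
     [/\ 0 < t < tau, \forall y \near x, closure Omega y -> Q y,
         b1 t - laplacian a x - euclid_grad a x `^ p < 0
       & boundary Omega x -> a x + b t <= 0]) ->
  forall x t, Q x -> 0 <= t <= tau -> a x + b t <= u x t.
Proof.
move=> [uc _ uvisc] Qc QO H x0 t0 Qx0 t0tau.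
pose K := Q `*` `[0, tau].
have Kc : compact K by apply: compact_setX => //; exact: segment_compact.
pose f (z : 'rV[R]_n * R) := u z.1 z.2 - (a z.1 + b z.2).
have fc : {within K, continuous f}.
  apply: (@continuous_sub _ (subspace K)); last first.
    by apply: continuous_subspaceT; exact: separated_continuous.
  apply: continuous_subspaceW uc => -[y s] [/= Qy]; rewrite in_itv/= =>
    /andP[s0 _].
  by split=> //; exact: QO.
have Kz0 : K (x0, t0) by split=> //=; rewrite in_itv.
have [[x1 t1] /set_mem[/= Qx1]] := compact_EVT_min (ex_intro _ _ Kz0) Kc fc.
rewrite in_itv/= => t1tau fmin.
suff : 0 <= f (x1, t1).
  by move=> /le_trans/(_ (fmin _ (mem_set Kz0))); rewrite subr_ge0.
rewrite /f subr_ge0/=.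
have [//|[/andP[t1_gt0 t1_lt] Qnear vneg bneg]] := H _ _ Qx1 t1tau.
(* Since [t1 < tau] and [Q] is a neighbourhood of [x1] relative to the closure, the minimum over [K]
   is also one relative to the closure and all positive times. *)
have locmin : local_min_rel (closure Omega `*` [set t : R | 0 < t])
    (fun y s => u y s - (a y + b s)) x1 t1.
  have tnear : \forall s \near t1, s < tau by exact: lt_nbhsl.
  have : \forall z \near (x1, t1), (closure Omega z.1 -> Q z.1) /\ z.2 < tau.
    by exists ([set y | closure Omega y -> Q y], [set s | s < tau]).
  apply: filterS => z [Qz z_lt] [/= Oz z_gt0].
  apply: (fmin (z.1, z.2)); apply: mem_set; split=> /=; first exact: Qz.
  by rewrite in_itv/= (ltW z_gt0)/= ltW.
have [Oint Obd] := (uvisc _ separated_C21 _ _ (QO _ Qx1) t1_gt0).2 locmin.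
have vhj_lt0 : vhj p (fun x t => a x + b t) x1 t1 < 0 by rewrite separated_vhj.
have [bx|nbx] := pselect (boundary Omega x1).
  have := Obd bx; rewrite le_max leNgt vhj_lt0/= => u_ge0.
  exact: le_trans (bneg bx) u_ge0.
have /Oint : Omega x1.
  by apply: interior_subset; apply: contrapT => ni; apply: nbx; split=> //;
    exact: QO.
by rewrite leNgt vhj_lt0.
Qed.

End separated_test_function.
End Comparison.

(** * Lower bounds on the whole domain *)

Section LowerBounds.
Context {R : realType} {n : nat}.
Implicit Types (Omega : set 'rV[R]_n) (p : R).

Lemma boundary_open Omega x : open Omega ->
  boundary Omega x <-> closure Omega x /\ ~ Omega x.
Proof.
move=> oO; split=> -[cx h]; split=> //; apply: contra_not h => h.
  by apply: open_nbhs_nbhs.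
exact: interior_subset h.
Qed.

Lemma closure_open_cases Omega x : open Omega -> closure Omega x ->
  boundary Omega x \/ Omega x.
Proof.
move=> oO cx; have [Ox|nOx] := pselect (Omega x); first by right.
by left; apply/(boundary_open x oO).
Qed.

(** For every [k > 0] the decreasing function [- k * expR (c * (t - t0))] is a negative strict
    subsolution with value [- k] at [t0]. The later barriers use the viscosity boundary condition
    only through this sign of [u]. *)
Lemma viscosity_ge0 Omega p (u0 : 'rV[R]_n -> R) u : compact (closure Omega) ->
  (forall x, closure Omega x -> 0 <= u0 x) ->
  global_viscosity_solution Omega p (u0 : 'rV[R]_n -> R) u ->
  forall x t, closure Omega x -> 0 <= t -> 0 <= u x t.
Proof.
move=> Oc u0_ge0 uvisc x0 t0 Ox0 t0_ge0; have [uc uinit _] := uvisc.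
pose K := closure Omega `*` `[0, t0 + 1].
have Kc : compact K by apply: compact_setX => //; exact: segment_compact.
have ucK : {within K, continuous (fun z : 'rV[R]_n * R => u z.1 z.2)}.
  by apply: continuous_subspaceW uc => -[y s] [/= Qy]; rewrite in_itv/= =>
    /andP[].
have K0 : K !=set0 by exists (x0, t0); split=> //=;
  rewrite in_itv/= t0_ge0 lerDl/=.
have [z1 _ umin] := compact_EVT_min K0 Kc ucK.
set m := u z1.1 z1.2 in umin.
apply/ler_addgt0Pr => k k_gt0; rewrite -lerBlDr sub0r.
(* As [expR c >= 1 + c], this rate brings [b] below the minimum [m] of [u] at the final time
   [t0 + 1]. *)
pose c := `|m| / k + 1.
have c_gt0 : 0 < c by rewrite ltr_wpDl// divr_ge0// ltW.
pose b (t : R) := - k * expR (c * (t - t0)).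
have db (t : R) : is_derive t (1 : R) b (- k * (expR (c * (t - t0)) * c)).
  apply: (@is_deriveZ _ _ _ (fun t => expR (c * (t - t0)))).
  apply: (@is_derive1_comp _ expR (fun t => c * (t - t0))).
  rewrite -[c in X in is_derive _ _ _ X]mulr1.
  apply: (@is_deriveZ _ _ _ (fun t => t - t0)).
  rewrite -[1 in X in is_derive _ _ _ X]subr0.
  exact: is_deriveB (is_derive_id _ _) (is_derive_cst _ _ _).
have cb1 : continuous (fun t => - k * (expR (c * (t - t0)) * c)).
  apply: continuous_scale; apply: (@continuous_mul _ R);
    last exact: cst_continuous.
  apply: continuous_comp1; first exact: continuous_expR.
  apply: continuous_scale; apply: continuous_sub; first by move=> ?;
    exact: cvg_id.
  exact: cst_continuous.
have := viscosity_comparison (C2_with_cst 0) db cb1 (tau := t0 + 1) uvisc Oc.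
move=> /(_ (fun x h => h) _ x0 t0 Ox0); rewrite t0_ge0 lerDl ler01.
rewrite add0r /b subrr mulr0 expR0 mulr1; apply=> // x t Ox /andP[t_ge0 t_le].
have [->|t_neq0] := eqVneq t 0.
  left; rewrite uinit// (le_trans _ (u0_ge0 _ Ox))// add0r mulNr oppr_le0.
  by rewrite mulr_ge0 ?expR_ge0// ltW.
have [->|t_neq] := eqVneq t (t0 + 1).
  left; apply: le_trans (umin (x, t0 + 1) _); last first.
    by apply: mem_set; split=> //=; rewrite in_itv/= lexx addr_ge0.
  rewrite add0r addrAC subrr add0r mulr1 mulNr lerNl.
  rewrite (le_trans (ler_norm _))// normrN mulrC -ler_pdivrMr//.
  rewrite (le_trans _ (expR_ge1Dx _))// /c addrCA lerDl.
  by rewrite addr_ge0.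
right; split.
- by rewrite !lt_neqAle eq_sym t_neq0 t_ge0 t_neq t_le.
- by near=> y.
- rewrite (C2_with_laplacian (C2_with_cst 0)) big1// subr0.
  rewrite subr_lt0 (lt_le_trans _ (powR_ge0 _ _))// mulNr oppr_lt0.
  by rewrite !mulr_gt0 ?expR_gt0.
- by move=> _; rewrite add0r mulNr oppr_le0 mulr_ge0 ?expR_ge0// ltW.
Unshelve. all: by end_near.
Qed.

(** The gradient term has the favourable sign, so the bound [C] on the Laplacian makes
    [N * (eta x - C * t)] a strict subsolution. The factor [N] scales out: the time scale of the
    decay depends on [eta] only. *)
Lemma viscosity_interior_bound Omega p (u0 : 'rV[R]_n -> R) u
    eta deta ddeta (N C : R) :
  open Omega -> compact (closure Omega) ->
  (forall x, closure Omega x -> 0 <= u0 x) ->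
  global_viscosity_solution Omega p (u0 : 'rV[R]_n -> R) u ->
  C2_with eta deta ddeta -> (forall x, boundary Omega x -> eta x = 0) ->
  0 < N -> (forall x, closure Omega x -> `|laplacian eta x| < C) ->
  (forall x, closure Omega x -> N * eta x <= u0 x) ->
  forall x t, closure Omega x -> 0 <= t -> N * (eta x - C * t) <= u x t.
Proof.
move=> oO Oc u0_ge0 uvisc eC2 ebd N_gt0 lapC eu0 x0 t0 Ox0 t0_ge0.
have u_ge0 := viscosity_ge0 Oc u0_ge0 uvisc.
have [ce _ _ _ _] := eC2; have [_ uinit _] := uvisc.
have C_gt0 : 0 < C by exact: le_lt_trans (lapC _ Ox0).
have [z _ emax] :=
  compact_EVT_max (ex_intro _ _ Ox0) Oc (continuous_subspaceT ce).
(* [z] maximises [eta], so from time [tau] on the lower function is nonpositive and [u >= 0]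
   suffices; comparison is needed on [[0, tau]] only. *)
pose tau := eta z / C.
have after t x : closure Omega x -> tau <= t -> N * (eta x - C * t) <= 0.
  move=> Ox; rewrite pmulr_rle0// subr_le0 ler_pdivrMr// [t * _]mulrC.
  by apply: le_trans; exact/emax/mem_set.
have [/(after _ _ Ox0)/le_trans|t0_lt] := leP tau t0; first by apply;
  exact: u_ge0.
pose b (t : R) := - (N * C) * t.
have db (t : R) : is_derive t (1 : R) b (- (N * C)).
  rewrite -[X in is_derive _ _ _ X]mulr1; apply: (@is_deriveZ _ _ _ id).
have := viscosity_comparison (C2_withZ N eC2) db (@cst_continuous _ _ _)
  (tau := tau) uvisc Oc (fun x h => h) _ (x := x0) (t := t0).
rewrite t0_ge0 (ltW t0_lt) mulrBr mulrA -mulNr; apply=> //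
  x t Ox /andP[t_ge0 t_le].
have [->|t_neq0] := eqVneq t 0; first by left;
  rewrite /b mulr0 addr0 uinit// eu0.
have [->|t_neq] := eqVneq t tau.
  left; rewrite /b mulNr -mulrA -mulrBr.
  by apply: le_trans (after _ _ Ox (lexx _)) (u_ge0 _ _ Ox _);
    rewrite (le_trans t_ge0).
have [bx|Ox'] := closure_open_cases oO Ox.
  left; rewrite ebd// mulr0 add0r; apply: le_trans (u_ge0 _ _ Ox t_ge0).
  by rewrite /b mulNr oppr_le0 !mulr_ge0// ltW.
right; split.
- by rewrite !lt_neqAle eq_sym t_neq0 t_ge0 t_neq t_le.
- by near=> y.
- rewrite (C2_with_laplacian (C2_withZ N eC2)) -mulr_sumr.
  rewrite -(C2_with_laplacian eC2) subr_lt0 (lt_le_trans _ (powR_ge0 _ _))//.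
  rewrite -opprD oppr_lt0 -mulrDr mulr_gt0//.
  by have := lapC _ Ox; rewrite ltr_norml => /andP[+ _];
    rewrite -subr_gt0 opprK addrC.
- by move=> /(boundary_open x oO)[].
Unshelve. all: by end_near.
Qed.

End LowerBounds.

(** * The boundary layer profile *)

Section Profile.
Context {R : realType}.
Implicit Types (s eps p : R).

Lemma is_derive_at_eq (f : R -> R) s (a b : R) :
  is_derive s (1 : R) f a -> a = b -> is_derive s (1 : R) f b.
Proof. by move=> ? <-. Qed.

Lemma is_derive_add1 (f g : R -> R) s (a b : R) :
  is_derive s (1 : R) f a -> is_derive s (1 : R) g b ->
  is_derive s (1 : R) (fun x => f x + g x) (a + b).
Proof. by move=> df dg; exact: is_deriveD df dg. Qed.

Lemma is_derive_mul1 (f g : R -> R) s (a b : R) :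
  is_derive s (1 : R) f a -> is_derive s (1 : R) g b ->
  is_derive s (1 : R) (fun x => f x * g x) (f s * b + g s * a).
Proof. by move=> df dg; exact: is_deriveM df dg. Qed.

Lemma is_derive_scale1 (k : R) (f : R -> R) s (a : R) :
  is_derive s (1 : R) f a -> is_derive s (1 : R) (fun x => k * f x) (k * a).
Proof. by move=> df; exact: (@is_deriveZ _ _ _ f k _ _ _ df). Qed.

Lemma is_derive_comp11 (G f : R -> R) s (a b : R) :
  is_derive (f s) (1 : R) G b -> is_derive s (1 : R) f a ->
  is_derive s (1 : R) (fun x => G (f x)) (b * a).
Proof. by move=> dG df; exact: is_derive1_comp dG df. Qed.

Lemma is_derive_inv1 (f : R -> R) s (a : R) : f s != 0 ->
  is_derive s (1 : R) f a ->
  is_derive s (1 : R) (fun x => (f x)^-1) (- f s ^- 2 * a).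
Proof. by move=> f0 df; exact: is_deriveV f0 df. Qed.

Definition reg_abs eps s : R := Num.sqrt (s ^+ 2 + eps ^+ 2).

(** For [eps > 0], this is arsinh(s / eps) + ln eps, a primitive of [1 / reg_abs eps]. Writing z^k
    as [expR (k * reg_ln eps s)] makes differentiation a multiplication by [k / reg_abs eps s]. *)
Definition reg_ln eps s : R := ln (s + reg_abs eps s).

Lemma reg_abs_gt0 eps s : 0 < eps -> 0 < reg_abs eps s.
Proof. by move=> e0; rewrite sqrtr_gt0 ltr_wpDl ?sqr_ge0// exprn_gt0. Qed.

Lemma reg_sum_gt0 eps s : 0 < eps -> 0 < s + reg_abs eps s.
Proof.
move=> e0; rewrite -ltrBlDl sub0r (le_lt_trans (ler_norm _))//
  normrN -sqrtr_sqr.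
by rewrite ltr_sqrt ?ltrDl ?exprn_gt0// ltr_wpDl ?sqr_ge0// exprn_gt0.
Qed.

Lemma is_derive_reg_abs eps s : 0 < eps ->
  is_derive s (1 : R) (reg_abs eps) (s / reg_abs eps s).
Proof.
move=> e0; have w0 := reg_abs_gt0 s e0.
have r0 : 0 < s ^+ 2 + eps ^+ 2 by rewrite ltr_wpDl ?sqr_ge0// exprn_gt0.
have d : is_derive s (1 : R) (fun x : R => x ^+ 2 + eps ^+ 2) (2 * s).
  have ds := is_derive_id s (1 : R).
  apply: is_derive_at_eq
    (is_derive_add1 (is_derive_mul1 ds ds)
      (is_derive_cst (eps ^+ 2) s (1 : R))) _.
  by rewrite addr0 mulr1 -mulr2n mulr_natl.
apply: is_derive_at_eq (is_derive_comp11
  (f := fun x => x ^+ 2 + eps ^+ 2) (is_derive1_sqrt r0) d) _.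
rewrite -/(reg_abs eps s); field.
by rewrite gt_eqF.
Qed.

Lemma is_derive_reg_ln eps s : 0 < eps ->
  is_derive s (1 : R) (reg_ln eps) (reg_abs eps s)^-1.
Proof.
move=> e0; have w0 := reg_abs_gt0 s e0; have z0 := reg_sum_gt0 s e0.
apply: is_derive_at_eq (is_derive_comp11
  (f := fun x => x + reg_abs eps x) (is_derive1_ln z0)
  (is_derive_add1 (is_derive_id s (1 : R)) (is_derive_reg_abs s e0))) _.
by field; rewrite !gt_eqF.
Qed.

Lemma is_derive_expR_reg_ln eps s (k : R) : 0 < eps ->
  is_derive s (1 : R) (fun x => expR (k * reg_ln eps x))
    (k * expR (k * reg_ln eps s) / reg_abs eps s).
Proof.
move=> e0; apply: is_derive_at_eq (is_derive_comp11
  (f := fun x => k * reg_ln eps x) (is_derive_expR _)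
  (is_derive_scale1 k (is_derive_reg_ln s e0))) _.
by rewrite mulrCA mulrA.
Qed.

(* z = s + reg_abs eps s is positive for every s, so the profile
   A z^beta - c / z is smooth on the whole line, as test functions must be. *)
Section profile_definition.
Variables (eps A c beta : R).

Definition profile s : R :=
  A * expR (beta * reg_ln eps s) + - c * expR (- 1 * reg_ln eps s).

Definition profile_num s : R :=
  beta * A * expR (beta * reg_ln eps s) + c * expR (- 1 * reg_ln eps s).

Definition profile1 s : R := profile_num s * (reg_abs eps s)^-1.

Definition profile2 s : R :=
  (beta ^+ 2 * A * expR (beta * reg_ln eps s) - c * expR (- 1 * reg_ln eps s)) *
    (reg_abs eps s) ^- 2 -
  profile_num s * s * (reg_abs eps s) ^- 3.

Hypothesis eps_gt0 : 0 < eps.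

Lemma profileC2 : C2_with1 profile profile1 profile2.
Proof.
have w0 s := reg_abs_gt0 s eps_gt0.
have d k s := is_derive_expR_reg_ln s k eps_gt0.
have cw : continuous (reg_abs eps).
  by apply: is_derive1_continuous => s; exact: is_derive_reg_abs.
have ce k : continuous (fun x => expR (k * reg_ln eps x)).
  exact: is_derive1_continuous (d k).
have cV m : continuous (fun s => reg_abs eps s ^- m).
  have wmN0 s : reg_abs eps s ^+ m != 0 by rewrite expf_neq0 ?gt_eqF.
  move=> s; apply: (@continuousV _ _ (fun s => reg_abs eps s ^+ m) s (wmN0 s)).
  exact: (continuous_comp1 (G := fun x => x ^+ m) (@exprn_continuous _ m) cw).
have dnum s : is_derive s (1 : R) profile_num ((beta ^+ 2 * A *
    expR (beta * reg_ln eps s) - c * expR (- 1 * reg_ln eps s)) / reg_abs eps s).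
  apply: is_derive_at_eq (is_derive_add1 (is_derive_scale1 (beta * A) (d beta s))
    (is_derive_scale1 c (d (- 1) s))) _.
  by ring.
split=> [s|s|].
- apply: is_derive_at_eq (is_derive_add1 (is_derive_scale1 A (d beta s))
    (is_derive_scale1 (- c) (d (- 1) s))) _.
  by rewrite /profile1 /profile_num; ring.
- have wN0 : reg_abs eps s != 0 by rewrite gt_eqF.
  apply: is_derive_at_eq (is_derive_mul1 (dnum s)
    (is_derive_inv1 wN0 (is_derive_reg_abs s eps_gt0))) _.
  rewrite /profile2.
  move: (profile_num s) (_ - _) (reg_abs eps s) wN0 => P M w wN0.
  by field.
- have cnum : continuous profile_num.
    exact: is_derive1_continuous dnum.
  have cid : continuous (fun s : R => s) by move=> ?; exact: cvg_id.
  rewrite /profile2; apply: continuous_sub.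
    apply: continuous_mul => //; apply: continuous_sub; exact: continuous_scale.
  apply: continuous_mul => //; exact: continuous_mul.
Qed.

End profile_definition.

(** Both A z^beta and the threshold [A' * rho / 8] are linear in [A'], so [delta] depends on [p] and
    [rho] alone. This order matters: [delta] enters the cut-off, whose Laplacian fixes the time
    scale, on which [A'] depends in turn. *)
Lemma barrier_profile p (rho : R) : 2 < p -> 0 < rho <= 1 ->
  exists2 delta : R, 0 < delta & forall A' eps : R, 0 < A' ->
    0 < eps <= delta ->
  exists G G1 G2 : R -> R, [/\ C2_with1 G G1 G2, G 0 <= - (A' * rho / 8),
    forall s, 0 <= s <= delta -> G s <= A' * rho / 8,
    forall s, 0 < s -> - (A' * rho / 8 * eps / s) <= G s
  & forall s, 0 <= s <= delta -> exists w, [/\ 0 < w <= 1, A' <= G1 s,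
      - G2 s <= 2 * G1 s / w & G1 s * A' `^ (p - 1) / w <= G1 s `^ p]].
Proof.
move=> p_gt2 /andP[rho_gt0 rho_le1]; have p1_gt0 : 0 < p - 1 by lra.
pose beta := (p - 2) / (p - 1).
have beta_gt0 : 0 < beta by rewrite divr_gt0//; lra.
have beta_lt1 : beta < 1 by rewrite ltr_pdivrMr//; lra.
have betaE : (beta - 1) * (p - 1) = - 1 by rewrite /beta; field; rewrite gt_eqF.
pose q := beta * rho / 8.
have q_gt0 : 0 < q by rewrite divr_gt0// mulr_gt0.
have q_lt1 : q < 1 by rewrite /q; nra.
(* [d] solves A d^beta = S, for the [A] and [S] introduced below. *)
pose d := expR (ln q / beta).
have d_gt0 : 0 < d by exact: expR_gt0.
have lnd : ln d = ln q / beta by rewrite expRK.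
have d_le1 : d <= 1.
  rewrite -expR0 ler_expR ler_pdivrMr// mul0r; exact/ln_le0/ltW.
(* For [s] and [eps] at most [d / 3], z <= 2 s + eps <= d. *)
exists (d / 3); first by rewrite divr_gt0.
move=> A' eps A'_gt0 /andP[eps_gt0 eps_le].
(* At [s = 0], where z = eps, the layer term c / z equals 2 S, whence G(0) <= S - 2 S. *)
pose S := A' * rho / 8; pose c := 2 * S * eps; pose A := A' / beta.
have S_gt0 : 0 < S by rewrite divr_gt0// mulr_gt0.
have c_gt0 : 0 < c by rewrite !mulr_gt0.
have A_gt0 : 0 < A by rewrite divr_gt0.
have bA : beta * A = A' by rewrite /A mulrC divfK ?gt_eqF.
exists (profile eps A c beta), (profile1 eps A c beta), (profile2 eps A c beta).
have w0 s := reg_abs_gt0 s eps_gt0.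
have z0 s := reg_sum_gt0 s eps_gt0.
have E2 s : expR (- 1 * reg_ln eps s) = (s + reg_abs eps s)^-1.
  by rewrite mulN1r expRN lnK// posrE.
have sw s : 0 <= s -> s <= reg_abs eps s.
  move=> s0; rewrite -[leLHS](ger0_norm s0) -sqrtr_sqr ler_sqrt.
    by rewrite lerDl sqr_ge0.
  by rewrite addr_ge0 ?sqr_ge0.
have ws s : 0 <= s -> reg_abs eps s <= s + eps.
  move=> s0; have se : 0 <= s + eps by rewrite addr_ge0// ltW.
  rewrite -[leRHS](ger0_norm se) -sqrtr_sqr ler_sqrt ?sqr_ge0//.
  by have := mulr_ge0 s0 (ltW eps_gt0); rewrite sqrrD; lra.
have E1 s : 0 <= s <= d / 3 -> A * expR (beta * reg_ln eps s) <= S.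
  move=> /andP[s0 sd].
  have -> : S = A * expR (beta * ln d).
    rewrite lnd [beta * _]mulrC divfK ?gt_eqF// lnK ?posrE// /S /A /q.
    by field; rewrite gt_eqF.
  rewrite ler_pM2l// ler_expR ler_pM2l// ler_ln ?posrE//.
  by have := ws s s0; lra.
have P0 s : 0 < profile_num eps A c beta s.
  by rewrite addr_gt0// mulr_gt0 ?expR_gt0// bA.
split.
- exact: profileC2.
- rewrite /profile E2 add0r.
  have -> : reg_abs eps 0 = eps by rewrite /reg_abs expr0n add0r sqrtr_sqr gtr0_norm.
  have -> : - c * eps^-1 = - S - S by rewrite /c; field; rewrite gt_eqF.
  have /E1 : (0 : R) <= 0 <= d / 3 by apply/andP; split; lra.
  by rewrite -/S; lra.
- move=> s sd; rewrite /profile E2 mulNr; apply: le_trans (E1 _ sd).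
  by rewrite gerBl divr_ge0 ?ltW.
- move=> s s0; rewrite /profile E2 mulNr.
  have : c / (s + reg_abs eps s) <= S * eps / s.
    have -> : S * eps / s = c / (2 * s) by rewrite /c; field; rewrite gt_eqF.
    rewrite ler_pM2l// lef_pV2 ?posrE ?mulr_gt0//.
    by have := sw s (ltW s0); lra.
  have : 0 < A * expR (beta * reg_ln eps s) by rewrite mulr_gt0 ?expR_gt0.
  by rewrite -/S; lra.
- move=> s /andP[s0 sd]; exists (reg_abs eps s).
  have w_le1 : reg_abs eps s <= 1 by have := ws s s0; lra.
  (* For [s >= 0] one has z >= w, so z^beta / w >= w^(beta - 1). *)
  have G1ge : A' * expR ((beta - 1) * ln (reg_abs eps s)) <= profile1 eps A c beta s.
    rewrite mulrBl mul1r expRD expRN lnK ?posrE// /profile1 mulrA.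
    rewrite ler_pM2r ?invr_gt0// /profile_num bA ler_wpDr//.
      by rewrite mulr_ge0 ?expR_ge0// ltW.
    by rewrite ler_pM2l// ler_expR ler_pM2l// ler_ln ?posrE// lerDr.
  split.
  + by rewrite w0.
  + apply: le_trans G1ge; rewrite ler_pMr// -[leLHS]expR0 ler_expR.
    by apply: mulr_le0; [rewrite subr_le0 ltW|exact: ln_le0].
  (* The only negative term of [M], - c / z, is compensated in [P]; with [s <= w], each of the two
     parts of - G'' is at most P / w^2. *)
  + rewrite /profile2 /profile1; set M := (X in X * _ ^- 2).
    set w := reg_abs eps s.
    have : - M <= profile_num eps A c beta s.
      have h k : 0 < k -> 0 < k * A * expR (beta * reg_ln eps s).
        by move=> k0; rewrite mulr_gt0 ?expR_gt0// mulr_gt0.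
      have := h _ (exprn_gt0 2 beta_gt0); have := h _ beta_gt0.
      by rewrite /M /profile_num; lra.
    have := P0 s; set P := profile_num _ _ _ _ _ => P_gt0 MP.
    have wm m : 0 < w ^- m by rewrite invr_gt0 exprn_gt0// w0.
    have -> : 2 * (P / w) / w = P * w ^- 2 + P * w * w ^- 3.
      by field; rewrite gt_eqF// w0.
    by rewrite opprB addrC lerD// -?mulNr ler_pM2r// ler_pM2l// sw.
  (* Split G'^p as G' times G'^(p - 1) and insert [G1ge]: since (beta - 1) (p - 1) = - 1, the power
     of w is exactly 1 / w. *)
  + have G1p : 0 < profile1 eps A c beta s by rewrite mulr_gt0 ?invr_gt0.
    rewrite -[leRHS]mulr_powRB1; [|exact: ltW|by lra].
    rewrite -mulrA ler_pM2l//.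
    have -> : A' `^ (p - 1) / reg_abs eps s =
        (A' * expR ((beta - 1) * ln (reg_abs eps s))) `^ (p - 1).
      rewrite powRM ?expR_ge0 ?(ltW A'_gt0)//; congr (_ * _).
      rewrite [X in _ = X]/powR gt_eqF ?expR_gt0//
        expRK mulrA [(p - 1) * _]mulrC.
      by rewrite betaE mulN1r expRN lnK// posrE.
    apply: ge0_ler_powR => //; first exact: ltW.
      by rewrite nnegrE mulr_ge0 ?expR_ge0// ltW.
    by rewrite nnegrE ltW.
Qed.

End Profile.

(** * Cut-off functions and Euclidean balls *)

Section Auxiliary.
Context {R : realType} {n : nat}.
Implicit Types (x : 'rV[R]_n) (s : R).

Lemma is_derive_maxX m s :
  is_derive s (1 : R) (fun y : R => Num.max y 0 ^+ m.+2)
    (m.+2%:R * Num.max s 0 ^+ m.+1).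
Proof.
have cmax : continuous (fun y : R => Num.max y 0).
  by move=> y; apply: continuous_max; [exact: cvg_id|exact: cvg_cst].
have dX (y : R) : is_derive y (1 : R) (fun z : R => z ^+ m.+2)
    (m.+2%:R * y ^+ m.+1).
  by split; [exact: exprn_derivable|rewrite exp_derive [LHS]mulr1].
have [s_lt0|s_gt0|->] := ltgtP s 0.
- rewrite expr0n/= mulr0.
  apply: near_eq_is_derive (is_derive_cst (0 : R) s (1 : R)).
  near=> y; rewrite max_r ?expr0n//= ltW//.
  by near: y; exact: lt_nbhsl.
- apply: near_eq_is_derive (dX s).
  near=> y; rewrite max_l// ltW//.
  by near: y; exact: lt_nbhsr.
(* At the kink, [Num.max y 0 ^+ m.+1] times [y] gives back the function, so it serves as the
   continuous slope of Caratheodory's criterion. *)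
- apply/is_derive1_caratheodory; exists (fun y => Num.max y 0 ^+ m.+1); split.
  + move=> y; rewrite maxxx expr0n/= subr0 subr0.
    by case: (leP y 0) => y0; [rewrite !expr0n/= mul0r|rewrite exprSr].
  + exact: (@continuous_comp1 _ _ (fun z => z ^+ m.+1))
      (@exprn_continuous _ _) cmax 0.
  + by rewrite maxxx !expr0n/= mulr0.
Unshelve. all: by end_near.
Qed.

(** Three is the least integer power that makes the positive part C^2. *)
Lemma maxX3_C2 : C2_with1 (fun s : R => Num.max s 0 ^+ 3)
  (fun s => 3 * Num.max s 0 ^+ 2) (fun s => 3 * (2 * Num.max s 0 ^+ 1)).
Proof.
split=> [s|s|].
- exact: is_derive_maxX.
- exact: is_derive_scale1 (is_derive_maxX _ _).
- do 2 apply: continuous_scale.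
  by move=> y; apply: continuous_max; [exact: cvg_id|exact: cvg_cst].
Qed.

(** The squared Euclidean distance is smooth, unlike the sup norm, so it can enter test
    functions. *)
Definition sqdist x0 x : R := \sum_(k < n) (x 0 k - x0 0 k) ^+ 2.

Lemma C2_with_eq (f g : 'rV[R]_n -> R) df dg ddf ddg :
  (forall x, f x = g x) -> (forall i x, df i x = dg i x) ->
  (forall i j x, ddf i j x = ddg i j x) -> C2_with f df ddf -> C2_with g dg ddg.
Proof.
move=> e1 e2 e3; have <- : f = g by exact/funext.
have <- : df = dg by apply/funext => i; exact/funext.
by have <- : ddf = ddg by do 2 apply/funext => ?; exact/funext.
Qed.

Lemma sqdist_C2 x0 : C2_with (sqdist x0)
  (fun i x => 2 * (x 0 i - x0 0 i)) (fun i j _ => 2 * (j == i)%:R).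
Proof.
have sub k := C2_withD (C2_with_coord k) (C2_with_cst (- x0 0 k)).
have eqs := C2_with_sum (fun k => C2_withM (sub k) (sub k)).
apply: C2_with_eq eqs => [x|i x|i j x].
- by apply: eq_bigr => k _; rewrite expr2.
- rewrite (bigD1 i)//= big1 => [|k /negPf ki].
    by rewrite eqxx /=; ring.
  by rewrite eq_sym ki /=; ring.
- rewrite (bigD1 i)//= big1 => [|k /negPf ki].
    by rewrite eqxx /=; ring.
  by rewrite [i == k]eq_sym ki /=; ring.
Qed.

Lemma sqdist_ge0 x0 x : 0 <= sqdist x0 x.
Proof. by apply: sumr_ge0 => k _; exact: sqr_ge0. Qed.

Lemma sqdistxx x : sqdist x x = 0.
Proof. by apply: big1 => k _; rewrite subrr expr0n. Qed.

Lemma coord_sqdist_lt x0 x (r : R) k : 0 < r -> sqdist x0 x < r ^+ 2 ->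
  `|x 0 k - x0 0 k| < r.
Proof.
move=> r0 xr; rewrite -sqrtr_sqr -[ltRHS](ger0_norm (ltW r0)) -sqrtr_sqr.
rewrite ltr_sqrt ?exprn_gt0//.
apply: le_lt_trans xr; rewrite /sqdist (bigD1 k)//= lerDl.
by apply: sumr_ge0 => j _; exact: sqr_ge0.
Qed.

Lemma coord_sqdist_le x0 x (r : R) k : 0 <= r -> sqdist x0 x <= r ^+ 2 ->
  `|x 0 k - x0 0 k| <= r.
Proof.
move=> r0 xr; rewrite -sqrtr_sqr -[leRHS](ger0_norm r0) -sqrtr_sqr.
rewrite ler_wsqrtr//.
apply: le_trans xr; rewrite /sqdist (bigD1 k)//= lerDl.
by apply: sumr_ge0 => j _; exact: sqr_ge0.
Qed.

Lemma sqdist_ball x0 x (r : R) : 0 < r -> sqdist x0 x < r ^+ 2 -> ball x0 r x.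
Proof.
move=> r0 xr; split=> // i j; rewrite (ord1 i) /ball/= distrC.
exact: coord_sqdist_lt.
Qed.

Lemma sqdist_compact x0 (r : R) : 0 <= r ->
  compact [set x | sqdist x0 x <= r ^+ 2].
Proof.
move=> r0; apply: bounded_closed_compact; last first.
  have [cq _ _ _ _] := sqdist_C2 x0.
  by apply: (preimage_closed (D := [set y | y <= r ^+ 2])) => //;
    exact: closed_le.
exists (`|x0| + r); split; first exact: num_real.
move=> M rM x /= xr; apply: le_trans (ltW rM).
rewrite -[x](subrK x0) addrC (le_trans (ler_normD _ _))// lerD2l.
rewrite [leLHS]/Num.Def.normr/= mx_normrE (bigmax_le _ r0)//= => -[i j] _ /=.
by rewrite (ord1 i) !mxE; exact: coord_sqdist_le.
Qed.

End Auxiliary.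

(** [D] stands for G', [E] for the Laplacian of the barrier, [g] for its gradient norm, [m] for the
    dimension. As A <= D <= D / w, all linear terms together are at most k D / w, with A - 1 = 2^p
    k. The factor 2^p pays for [D / 2] in the bound on [g]; the summand 1 gives strictness and A <=
    A^(p - 1). *)
Lemma barrier_inequality (R : realType) (p rho T L A D w E g m b : R) :
  2 < p -> 0 < rho -> 0 < T -> 0 <= m -> 0 <= L -> 0 < w <= 1 ->
  A = 1 + 2 `^ p * ((2 * T)^-1 + 3 * L + m / (2 * rho)) -> A <= D ->
  D * A `^ (p - 1) / w <= D `^ p -> b <= A / (2 * T) ->
  - (D * L + 2 * D / w * L + m * A / (2 * rho)) <= E -> D / 2 <= g ->
  b - E - g `^ p < 0.
Proof.
move=> p_gt2 rho_gt0 T_gt0 m_ge0 L_ge0 /andP[w_gt0 w_le1] AE AD DA bA EL Dg.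
set k := _ + _ + _ in AE.
have T2 : 0 < (2 * T)^-1 by rewrite invr_gt0 mulr_gt0.
have mr : 0 <= m / (2 * rho) by rewrite divr_ge0// mulr_ge0// ltW.
have k_ge0 : 0 <= k by rewrite /k; lra.
have P_gt0 : 0 < 2 `^ p :> R by rewrite powR_gt0.
have A_ge1 : 1 <= A by rewrite AE lerDl mulr_ge0// ltW.
have D_gt0 : 0 < D by lra.
have Dw : D <= D / w by rewrite ler_pdivlMr// ler_piMr// ltW.
have lin : b - E <= D / w * k.
  have h1 : A / (2 * T) <= D / w * (2 * T)^-1.
    by rewrite ler_pM2r// (le_trans AD).
  have h2 : m * A / (2 * rho) <= D / w * (m / (2 * rho)).
    by rewrite mulrAC mulrC ler_wpM2r// (le_trans AD).
  have h3 : D * L <= D / w * L by rewrite ler_wpM2r.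
  have -> : D / w * k = D / w * (2 * T)^-1 + 2 * D / w * L + D / w * L +
      D / w * (m / (2 * rho)) by rewrite /k; ring.
  by lra.
suff : D / w * k < g `^ p by lra.
apply: (@lt_le_trans _ _ ((D / 2) `^ p)); last first.
  by apply: ge0_ler_powR; rewrite ?nnegrE; lra.
rewrite powRM ?invr_ge0 ?(ltW D_gt0)// -[2^-1](@powR_inv1 _ 2)//
  -powRrM mulN1r powRN.
rewrite ltr_pdivlMr//; apply: lt_le_trans DA.
have AA : A <= A `^ (p - 1) by apply: le1r_powR => //; lra.
have -> : D / w * k * 2 `^ p = D / w * (A - 1) by rewrite AE; ring.
by rewrite [ltRHS]mulrAC ltr_pM2l ?divr_gt0//; lra.
Qed.

(** * Boundary charts *)

Section BoundaryChart.
Context {R : realType} {n : nat}.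
Implicit Types (x y : 'rV[R]_n).

(** [h] is the height above the graph. Its [i]-th derivative bounds the gradient from below, and [v]
    is a direction along which the height grows at unit rate. *)
Definition boundary_chart (Omega : set 'rV[R]_n) x0 (r : R)
    (h : 'rV[R]_n -> R) dh ddh (i : 'I_n) : Prop :=
  [/\ C2_with h dh ddh, forall x, `|dh i x| = 1,
      exists v : 'rV[R]_n, forall x t, h (x + t *: v) = h x + t
    & forall x, sqdist x0 x < r ^+ 2 -> (Omega x <-> 0 < h x)].

(** The height is [sigma * x 0 i - gamma x]. As [gamma] is constant along [e_ i], its [i]-th
    derivative is [sigma], and [sigma ^+ 2 = 1] makes [sigma *: e_ i] the unit-rate direction. *)
Lemma boundary_chart_exists (alpha : R) Omega x0 : class_C2alpha alpha Omega ->
  boundary Omega x0 ->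
  exists r h dh ddh i, 0 < r /\ boundary_chart Omega x0 r h dh ddh i.
Proof.
move=> reg /reg[r [i [sg [gamma [r_gt0 [gC2 _] ginv graph]]]]].
pose sigma : R := (-1) ^+ sg.
have ss : sigma * sigma = 1 by rewrite -expr2 sqrr_sign.
have hC2 := C2_withD (C2_withZ sigma (C2_with_coord i)) (C2_withZ (-1) (C2P gC2)).
exists r; do 3 eexists; exists i; split=> //; split; first exact: hC2.
- move=> x; have -> : partial i gamma x = 0.
    rewrite /partial /derive; set F := (X in lim (X @ _)).
    have -> : F = fun=> 0.
      by apply/funext => t; rewrite /F/= [t *: _ + _]addrC ginv subrr scaler0.
    exact/lim_cst.
  by rewrite eqxx mulr1 mulr0 addr0 normrX normrN1 expr1n.
- exists (sigma *: e_ i) => x t; rewrite scalerA ginv !mxE !eqxx/=.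
  rewrite mulr1 mulrDr mulrCA ss; ring.
- move=> x /(sqdist_ball r_gt0)/graph ->.
  by rewrite mulN1r subr_gt0.
Qed.

Section chart.
Context {Omega : set 'rV[R]_n} {x0 : 'rV[R]_n} {r : R} {h : 'rV[R]_n -> R}
  {dh : 'I_n -> 'rV[R]_n -> R} {ddh : 'I_n -> 'I_n -> 'rV[R]_n -> R} {i : 'I_n}.
Hypotheses (oO : open Omega) (bx0 : boundary Omega x0) (r_gt0 : 0 < r)
  (chart : boundary_chart Omega x0 r h dh ddh i).

Lemma chart_continuous : continuous h.
Proof. by case: chart => -[]. Qed.

Lemma sqdist_continuous : continuous (sqdist x0).
Proof. by case: (sqdist_C2 x0). Qed.

Lemma sqdist_near x (c : R) : sqdist x0 x < c -> \forall y \near x,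
  sqdist x0 y < c.
Proof. move=> xc; exact: (@sqdist_continuous x _ (lt_nbhsl xc)). Qed.

Lemma chart_near_lt x (c : R) : h x < c -> \forall y \near x, h y < c.
Proof. move=> xc; exact: (@chart_continuous x _ (lt_nbhsl xc)). Qed.

Lemma chart_closure_ge0 x : closure Omega x -> sqdist x0 x < r ^+ 2 -> 0 <= h x.
Proof.
move=> cx xr; rewrite leNgt; apply/negP => hx.
have [y [Oy [qy hy]]] := cx _ (filterI (sqdist_near xr) (chart_near_lt hx)).
case: chart => _ _ _ /(_ _ qy)[+ _] => /(_ Oy).
by rewrite ltNge (ltW hy).
Qed.

Lemma chart_boundary x : boundary Omega x -> sqdist x0 x < r ^+ 2 -> h x = 0.
Proof.
move=> /(boundary_open x oO)[cx nOx] xr; apply/eqP.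
rewrite eq_le (chart_closure_ge0 cx xr) andbT leNgt; apply/negP.
by case: chart => _ _ _ /(_ _ xr)[_ +] => /[apply].
Qed.

(** A small move along [v] makes the height positive, that is, enters [Omega]. *)
Lemma chart_closure x : 0 <= h x -> sqdist x0 x < r ^+ 2 -> closure Omega x.
Proof.
move=> hx xr B Bx; case: chart => _ _ [v hv] graph.
have cv : (fun t : R => x + t *: v) @ 0^'+ --> x.
  rewrite -[X in _ --> X]addr0 -(scale0r v); apply: cvg_at_right_filter.
  by apply: cvgD; [exact: cvg_cst|apply: cvgZr_tmp; exact: cvg_id].
have [t [[t_gt0 Bt] rt]] : exists t : R, ((0 < t) /\ B (x + t *: v)) /\
    sqdist x0 (x + t *: v) < r ^+ 2.
  have [|t ?] := @filter_ex _ 0^'+ _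
      [set t : R | ((0 < t) /\ B (x + t *: v)) /\ sqdist x0 (x + t *: v) < r ^+ 2].
    apply: filterI; first apply: filterI.
    - exact: nbhs_right_gt.
    - exact: cv Bx.
    - exact: cv (sqdist_near xr).
  by exists t.
by exists (x + t *: v); split=> //; apply/graph => //; rewrite hv ltr_wpDl.
Qed.

Lemma chart_center : h x0 = 0.
Proof. by apply: chart_boundary => //; rewrite sqdistxx exprn_gt0. Qed.

Lemma chart_compact (rho delta : R) : 0 < rho < r ->
  compact [set x | sqdist x0 x <= rho ^+ 2 /\ (0 <= h x <= delta)].
Proof.
move=> /andP[rho_gt0 _].
have cQ := sqdist_compact (x0 := x0) (ltW rho_gt0).
apply: subclosed_compact cQ _; last by move=> x [].
have -> : [set x | sqdist x0 x <= rho ^+ 2 /\ (0 <= h x <= delta)] =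
    [set x | sqdist x0 x <= rho ^+ 2] `&` ([set x | 0 <= h x] `&` [set x | h x <= delta]).
  by apply/seteqP; split=> x /=; [move=> [? /andP[]]|move=> [? [? ?]];
    split=> //; exact/andP].
have cq := sqdist_continuous; have ch := chart_continuous.
apply: closedI; last apply: closedI.
- by apply: (preimage_closed (D := [set y | y <= _])) => //; exact: closed_le.
- by apply: (preimage_closed (f := h) (D := [set y | 0 <= y])) => //;
    exact: closed_ge.
- by apply: (preimage_closed (D := [set y | y <= _])) => //; exact: closed_le.
Qed.

Lemma chart_bounds (rho : R) : 0 <= rho -> exists2 L : R, 0 <= L &
  forall x, sqdist x0 x <= rho ^+ 2 ->
    \sum_(k < n) dh k x ^+ 2 <= L /\ `|\sum_(k < n) ddh k k x| <= L.
Proof.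
move=> rho_ge0; have Kc := sqdist_compact (x0 := x0) rho_ge0.
have K0 : [set x | sqdist x0 x <= rho ^+ 2] !=set0.
  by exists x0; rewrite /= sqdistxx sqr_ge0.
case: chart => -[_ _ cdh _ cddh] _ _ _.
have c1 : continuous (fun x => \sum_(k < n) dh k x ^+ 2).
  by apply: continuous_bigsum => k;
    exact: (continuous_comp1 (@exprn_continuous _ 2) (cdh k)).
have c2 : continuous (fun x => `|\sum_(k < n) ddh k k x|).
  by apply: (continuous_comp1 (@norm_continuous _ _)); exact: continuous_bigsum.
have [z1 _ m1] := compact_EVT_max K0 Kc (continuous_subspaceT c1).
have [z2 _ m2] := compact_EVT_max K0 Kc (continuous_subspaceT c2).
exists (\sum_(k < n) dh k z1 ^+ 2 + `|\sum_(k < n) ddh k k z2|).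
  by rewrite addr_ge0// sumr_ge0// => k _; exact: sqr_ge0.
move=> x xr; split.
- by rewrite (le_trans (m1 _ (mem_set xr)))// lerDl.
- rewrite (le_trans (m2 _ (mem_set xr)))// lerDr sumr_ge0// => k _.
  exact: sqr_ge0.
Qed.

End chart.
End BoundaryChart.

(** * The barrier near a boundary point *)

Section LocalBarrier.
Context {R : realType} {n : nat}.
Implicit Types (Omega U : set 'rV[R]_n) (eta : 'rV[R]_n -> R).

(** [S] and [c] are fixed before the data and the solution, so one choice serves all larger data. *)
Definition barrier_conclusion Omega (p : R) eta U (T S c : R) : Prop :=
  forall (u0 : 'rV[R]_n -> R) u, global_viscosity_solution Omega p u0 u ->
    (forall x t, closure Omega x -> 0 <= t -> 0 <= u x t) ->
    (forall x t, closure Omega x -> 0 <= t <= 2 * T -> 1 <= eta x ->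
      S <= u x t) ->
    forall x, boundary Omega x -> U x -> c <= u x T.

(** [T] comes after [eta] and [U] because the common time is found only once finitely many cut-offs
    have been summed. *)
Definition local_barrier Omega (p : R) (x0 : 'rV[R]_n) eta U : Prop :=
  [/\ C2 eta, forall x, 0 <= eta x, forall x, boundary Omega x -> eta x = 0,
    open U /\ U x0
  & forall T, 0 < T -> exists S c : R,
    0 < c /\ barrier_conclusion Omega p eta U T S c].

End LocalBarrier.

Section BoundaryBarrier.
Context {R : realType} {n : nat} {Omega : set 'rV[R]_n} {x0 : 'rV[R]_n} {r : R}
  {h : 'rV[R]_n -> R} {dh : 'I_n -> 'rV[R]_n -> R}
  {ddh : 'I_n -> 'I_n -> 'rV[R]_n -> R} {i : 'I_n}.
Hypotheses (oO : open Omega) (bx0 : boundary Omega x0) (r_gt0 : 0 < r)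
  (chart : boundary_chart Omega x0 r h dh ddh i).

(* Returns to -S at time 2 T: the barrier then lies below u at both ends of
   [0, 2 T], so that no viscosity inequality at a final time is needed. *)
Definition time_profile (S T t : R) : R := - S + 2 * S * (t / T * (2 - t / T)).

Lemma is_derive_time_profile (S T t : R) : 0 < T ->
  is_derive t (1 : R) (time_profile S T) (4 * S / T * (1 - t / T)).
Proof.
move=> T0; have dt := is_derive_scale1 T^-1 (is_derive_id t (1 : R)).
have d2 := is_derive_add1 (is_derive_cst (2 : R) t (1 : R))
  (is_derive_scale1 (- 1) dt).
have := is_derive_add1 (is_derive_cst (- S) t (1 : R))
  (is_derive_scale1 (2 * S) (is_derive_mul1 dt d2)).
have -> : (fun y =>
  cst (- S) y + 2 * S * (T^-1 * id y * (cst 2 y + -1 * (T^-1 * id y)))) =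
    time_profile S T by apply/funext => y; rewrite /time_profile/=; field;
      rewrite gt_eqF.
by move/is_derive_at_eq; apply; field; rewrite gt_eqF.
Qed.

Lemma time_profile_le (S T t : R) : 0 < T -> 0 <= S -> time_profile S T t <= S.
Proof.
move=> T0 S0; rewrite /time_profile; set a := t / T.
have -> : a * (2 - a) = 1 - (1 - a) ^+ 2 by ring.
by have := mulr_ge0 S0 (sqr_ge0 (1 - a)); lra.
Qed.

Section barrier_function.
Variables (p rho delta T L A : R) (G G1 G2 : R -> R).
Let S := A * rho / 8.
(** This value gives B rho^2 = 2 S, which absorbs G and the time profile at distance [rho], and 2 B
    rho = A / 2, at most half of G'. *)
Let B := A / (4 * rho).
Hypotheses (p_gt2 : 2 < p) (rho_gt0 : 0 < rho) (rho_le1 : rho <= 1)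
  (rho_r : 2 * rho <= r) (T_gt0 : 0 < T) (L_ge0 : 0 <= L)
  (HL : forall x, sqdist x0 x <= rho ^+ 2 ->
    \sum_(k < n) dh k x ^+ 2 <= L /\ `|\sum_(k < n) ddh k k x| <= L)
  (AE : A = 1 + 2 `^ p * ((2 * T)^-1 + 3 * L + n%:R / (2 * rho)))
  (GC2 : C2_with1 G G1 G2) (G0 : G 0 <= - S)
  (GS : forall s, 0 <= s <= delta -> G s <= S)
  (Gineq : forall s, 0 <= s <= delta -> exists w, [/\ 0 < w <= 1, A <= G1 s,
      - G2 s <= 2 * G1 s / w & G1 s * A `^ (p - 1) / w <= G1 s `^ p]).

Let Q := [set x | sqdist x0 x <= rho ^+ 2 /\ 0 <= h x <= delta].

Let A_gt0 : 0 < A.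
Proof.
rewrite AE ltr_wpDr// mulr_ge0// ?powR_ge0// !addr_ge0// ?mulr_ge0//.
  by rewrite invr_ge0 mulr_ge0// ltW.
by rewrite invr_ge0 mulr_ge0// ltW.
Qed.

Let S_gt0 : 0 < S. Proof. by rewrite divr_gt0// mulr_gt0. Qed.

Let B_gt0 : 0 < B. Proof. by rewrite divr_gt0// mulr_gt0. Qed.

Let rho_lt_r : rho < r. Proof. by move: rho_gt0 rho_r; lra. Qed.

Let rho2_r2 x : sqdist x0 x <= rho ^+ 2 -> sqdist x0 x < r ^+ 2.
Proof.
move=> /le_lt_trans; apply; rewrite ltr_pXn2r ?nnegrE//; exact: ltW.
Qed.

Definition barrier x : R := G (h x) + - B * sqdist x0 x.

Let hC2 : C2_with h dh ddh. Proof. by case: chart. Qed.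

Let barrierC2 :=
  C2_withD (C2_with_comp GC2 hC2) (C2_withZ (- B) (sqdist_C2 x0)).

Lemma barrier_strict x t : Q x -> 0 <= t -> 4 * S / T * (1 - t / T) -
  laplacian barrier x - euclid_grad barrier x `^ p < 0.
Proof.
move=> [xr hx] t_ge0; have [w [w01 AG G2G Gp]] := Gineq hx.
have [sq lap] := HL xr.
have G1_gt0 : 0 < G1 (h x) by exact: lt_le_trans AG.
have [w_gt0 _] := andP w01.
apply: (barrier_inequality (T := T) (rho := rho) (m := n%:R) p_gt2 rho_gt0
  T_gt0 (ler0n _ _) L_ge0 w01 AE AG Gp).
- have -> : 4 * S / T * (1 - t / T) = A / (2 * T) * (rho * (1 - t / T)).
    by rewrite /S; field; rewrite gt_eqF.
  rewrite ger_pMr ?divr_gt0// ?mulr_gt0//.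
  have : 0 <= rho * (t / T) by rewrite mulr_ge0 ?(ltW rho_gt0)// divr_ge0// ltW.
  by move: rho_le1; lra.
- rewrite (C2_with_laplacian barrierC2) big_split/= big_split/=.
  rewrite -mulr_sumr.
  have -> : \sum_(k < n) dh k x * (G2 (h x) * dh k x) =
      G2 (h x) * \sum_(k < n) dh k x ^+ 2.
    by rewrite mulr_sumr; apply: eq_bigr => k _; rewrite mulrCA expr2.
  have -> : \sum_(k < n) - B * (2 * (k == k)%:R) = - (n%:R * A / (2 * rho)).
    under eq_bigr do rewrite eqxx.
    rewrite sumr_const card_ord -mulr_natl /B /=; field.
    by rewrite gt_eqF.
  rewrite opprD lerD2r opprD; apply: lerD.
  + by rewrite -mulrN ler_pM2l//; move: lap; rewrite ler_norml => /andP[].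
  + set q := \sum_(k < n) _ in sq *.
    have q_ge0 : 0 <= q by apply: sumr_ge0 => k _; exact: sqr_ge0.
    rewrite lerNl -mulNr (le_trans (ler_wpM2r q_ge0 G2G))// ler_wpM2l//.
    by rewrite divr_ge0 ?mulr_ge0 ?ltW.
(* The [i]-th derivative is enough: the chart contributes G' in absolute value, and the paraboloid
   at most A / 2 <= G' / 2. *)
- apply: le_trans (C2_with_grad_ge barrierC2 i x) => /=.
  have [_ dhi _ _] := chart.
  have xi : `|x 0 i - x0 0 i| <= rho by apply: coord_sqdist_le => //;
    exact: ltW.
  rewrite (le_trans _ (lerB_normD _ _))// !normrM dhi mulr1 normrN.
  rewrite (gtr0_norm B_gt0) normr_nat (gtr0_norm G1_gt0).
  have : B * (2 * `|x 0 i - x0 0 i|) <= B * (2 * rho).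
    by rewrite ler_pM2l// ler_pM2l.
  have -> : B * (2 * rho) = A / 2 by rewrite /B; field; rewrite gt_eqF.
  by move: AG; lra.
Qed.

(** The barrier is at most S + S where [h x = delta], - S + S where [h x = 0], S - 2 S + S at
    distance [rho], and S - S at both end times. Everywhere else it is a strict subsolution, and
    boundary points of [Omega] in [Q] have height zero. *)
Lemma barrier_below (u0 : 'rV[R]_n -> R) u :
  global_viscosity_solution Omega p u0 u ->
  (forall x t, closure Omega x -> 0 <= t -> 0 <= u x t) ->
  (forall x t, Q x -> h x = delta -> 0 <= t <= 2 * T -> 2 * S <= u x t) ->
  forall x t, Q x -> 0 <= t <= 2 * T -> barrier x + time_profile S T t <= u x t.
Proof.
move=> uvisc u_ge0 u_ge.
have QO : Q `<=` closure Omega.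
  by move=> x [xr /andP[hx _]]; apply: (chart_closure chart hx); exact: rho2_r2.
have dtp (t : R) :
    is_derive t (1 : R) (time_profile S T) (4 * S / T * (1 - t / T)).
  exact: is_derive_time_profile.
have ctp : continuous (fun t : R => 4 * S / T * (1 - t / T)).
  have cid : continuous (fun t : R => t) by move=> ?; exact: cvg_id.
  apply: continuous_scale; apply: continuous_sub; first exact: cst_continuous.
  by apply: continuous_mul => //; exact: cst_continuous.
have Qc : compact Q by apply: (chart_compact chart); rewrite rho_gt0.
apply: (viscosity_comparison barrierC2 dtp ctp uvisc Qc QO).
move=> x t Qx /andP[t_ge0 t_le]; have Ox := QO _ Qx.
have [xr hx] := Qx; have u0xt := u_ge0 x t Ox t_ge0.
have tpS : time_profile S T t <= S by exact: time_profile_le (ltW S_gt0).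
have GxS := GS hx; have q_ge0 := mulr_ge0 (ltW B_gt0) (sqdist_ge0 x0 x).
have [hd|hd] := eqVneq (h x) delta.
  left; apply: le_trans (u_ge _ _ Qx hd _); last exact/andP.
  by rewrite /barrier mulNr; lra.
have [h0|h0] := eqVneq (h x) 0.
  by left; apply: le_trans u0xt; rewrite /barrier h0 mulNr; move: G0; lra.
have [qr|qr] := eqVneq (sqdist x0 x) (rho ^+ 2).
  left; apply: le_trans u0xt; rewrite /barrier mulNr qr.
  have -> : B * rho ^+ 2 = 2 * S by rewrite /B /S; field; rewrite gt_eqF.
  by lra.
have ends : time_profile S T t = - S -> barrier x + time_profile S T t <= u x t.
  by move=> ->; apply: le_trans u0xt; rewrite /barrier mulNr; lra.
have [t0|t0] := eqVneq t 0.
  by left; apply: ends; rewrite /time_profile t0 !mul0r mulr0 addr0.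
have [t1|t1] := eqVneq t (2 * T).
  by left; apply: ends; rewrite /time_profile t1; field; rewrite gt_eqF.
have [/andP[hx0 hx1] hxd] := (hx, hx).
right; split.
- by rewrite !lt_neqAle eq_sym t0 t_ge0 t1 t_le.
- have hlt : h x < delta by rewrite lt_neqAle hd.
  have qlt : sqdist x0 x < rho ^+ 2 by rewrite lt_neqAle qr.
  near=> y => Oy; split; first by apply: ltW; near: y; exact: sqdist_near.
  apply/andP; split; last by apply: ltW; near: y; exact: (chart_near_lt chart).
  apply: (chart_closure_ge0 chart Oy); apply: rho2_r2.
  by apply: ltW; near: y; exact: sqdist_near.
- exact: barrier_strict.
- move=> bx; have := chart_boundary oO chart bx (rho2_r2 xr).
  by move/eqP; rewrite (negbTE h0).
Unshelve. all: by end_near.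
Qed.

End barrier_function.

Lemma local_barrier_exists (p : R) : 2 < p ->
  exists eta U, local_barrier Omega p x0 eta U.
Proof.
move=> p_gt2; pose rho := Num.min 1 (r / 2).
have rho_gt0 : 0 < rho by rewrite lt_min ltr01 divr_gt0.
have rho_le1 : rho <= 1 by rewrite ge_min lexx.
have rho_r : 2 * rho <= r by rewrite mulrC -ler_pdivlMr// ge_min lexx orbT.
have rho01 : 0 < rho <= 1 by rewrite rho_gt0.
have [delta delta_gt0 prof] := barrier_profile p_gt2 rho01.
have [L L_ge0 HL] := chart_bounds (x0 := x0) chart (ltW rho_gt0).
have [hC2 _ _ _] := chart.
have ch := chart_continuous chart; have cq := sqdist_continuous (x0 := x0).
have small x : sqdist x0 x < 4 * rho ^+ 2 -> sqdist x0 x < r ^+ 2.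
  move=> /lt_le_trans; apply; have -> : 4 * rho ^+ 2 = (2 * rho) ^+ 2 by ring.
  by rewrite ler_pXn2r ?nnegrE// ?mulr_ge0// ltW.
pose bump (s : R) := Num.max s 0 ^+ 3.
have bump_ge0 s : 0 <= bump s by rewrite exprn_ge0// le_max lexx orbT.
have bump0 s : s <= 0 -> bump s = 0 by move=> s0; rewrite /bump max_r// expr0n.
(* Dividing by [k] makes the cut-off at least 1 where [h x = delta] within distance [rho]. It
   vanishes on the boundary: through the height within distance [2 * rho], through the radial factor
   beyond. *)
pose k := delta ^+ 3 * (3 * rho ^+ 2) ^+ 3.
have k_gt0 : 0 < k by rewrite mulr_gt0 ?exprn_gt0// mulr_gt0// exprn_gt0.
have radC2 :=
  C2_withD (C2_with_cst (4 * rho ^+ 2)) (C2_withZ (-1) (sqdist_C2 x0)).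
have etaC2 := C2_withZ k^-1
  (C2_withM (C2_with_comp maxX3_C2 hC2) (C2_with_comp maxX3_C2 radC2)).
eexists; exists ([set x | sqdist x0 x < rho ^+ 2 / 4] `&` [set x | h x < delta]).
split; first exact: C2_with_C2 etaC2.
- move=> x; apply: mulr_ge0; first by rewrite invr_ge0 ltW.
  by apply: mulr_ge0; exact: bump_ge0.
- move=> x bx.
  suff e : bump (h x) * bump (4 * rho ^+ 2 + -1 * sqdist x0 x) = 0.
    exact: etrans (congr1 ( *%R k^-1) e) (mulr0 _).
  have [/small xr|xr] := ltP (sqdist x0 x) (4 * rho ^+ 2).
    by rewrite (chart_boundary oO chart bx xr) bump0 ?mul0r.
  by rewrite [X in _ * X]bump0 ?mulr0// mulN1r subr_le0.
- split.
    apply: openI.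
      by apply: (open_comp (f := sqdist x0) (D := [set y | y < _])) => //;
        exact: open_lt.
    by apply: (open_comp (f := h) (D := [set y | y < _])) => //; exact: open_lt.
  split=> /=; first by rewrite sqdistxx ?divr_gt0// exprn_gt0.
  by have -> := chart_center oO bx0 r_gt0 chart.
move=> T T_gt0.
pose A := 1 + 2 `^ p * ((2 * T)^-1 + 3 * L + n%:R / (2 * rho)).
have A_gt0 : 0 < A.
  rewrite ltr_wpDr// mulr_ge0// ?powR_ge0// !addr_ge0// ?mulr_ge0//.
    by rewrite invr_ge0 mulr_ge0// ltW.
  by rewrite invr_ge0 mulr_ge0// ltW.
pose S := A * rho / 8; have S_gt0 : 0 < S by rewrite divr_gt0// mulr_gt0.
(* 2 S is the value required on the top [h x = delta]; S / 4 is what remains of S at time [T] after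
   losing S / 2 to the paraboloid and S / 4 to the layer. *)
exists (2 * S), (S / 4); split; first exact: divr_gt0.
move=> u0 u uvisc u_ge0 u_ge.
have inside y : Omega y -> sqdist x0 y < rho ^+ 2 / 4 -> h y < delta ->
  S / 4 <= u y T.
  move=> Oy yrho hyd.
  have yrho2 : sqdist x0 y < rho ^+ 2.
    by apply: lt_trans yrho _; rewrite gtr_pMr ?exprn_gt0//; lra.
  have hy : 0 < h y.
    have [_ _ _ graph] := chart; apply/(graph y) => //; apply: small.
    by apply: lt_trans yrho2 _; rewrite ltr_pMl ?exprn_gt0//; lra.
  (* The layer width is adapted to the point: with eps = h(y) / 4 the layer costs at most S / 4 at
     [y], uniformly in [y]. *)
  have eps_in : 0 < h y / 4 <= delta by rewrite divr_gt0//=; lra.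
  have [G [G1 [G2 [GC2 G0 GS Glow Gineq]]]] := prof A (h y / 4) A_gt0 eps_in.
  have := barrier_below p_gt2 rho_gt0 rho_le1 rho_r T_gt0 L_ge0 HL
    (erefl A) GC2 G0 GS Gineq uvisc u_ge0 _.
  move=> /(_ _ y T) H.
  have : barrier rho A G y + time_profile S T T <= u y T.
    apply: H => //=.
    + move=> x t [xrho /andP[hx0 _]] hxd tT; apply: u_ge => //.
        apply: (chart_closure chart hx0); apply: small.
        by apply: le_lt_trans xrho _; rewrite ltr_pMl ?exprn_gt0//; lra.
      have r3 : 0 <= 3 * rho ^+ 2 by rewrite mulr_ge0// sqr_ge0.
      rewrite hxd ler_pdivlMl// mulr1 /k; apply: ler_pM.
      * by rewrite exprn_ge0// ltW.
      * by rewrite exprn_ge0.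
      * by rewrite max_l// ltW.
      * rewrite max_l; last by lra.
        by rewrite ler_pXn2r ?nnegrE//; lra.
    + by split; [exact: ltW|rewrite !ltW].
    + by apply/andP; split; lra.
  have TT : time_profile S T T = S by rewrite /time_profile; field;
    rewrite gt_eqF.
  have := Glow _ hy; have -> : A * rho / 8 * (h y / 4) / h y = S / 4.
    by rewrite /S; field; rewrite gt_eqF.
  have : A / (4 * rho) * sqdist x0 y <= A / (4 * rho) * (rho ^+ 2 / 4).
    by rewrite ler_pM2l ?divr_gt0 ?mulr_gt0// ltW.
  have -> : A / (4 * rho) * (rho ^+ 2 / 4) = S / 2.
    by rewrite /S; field; rewrite gt_eqF.
  by rewrite TT /barrier mulNr; lra.
(* The bound at interior points passes to the boundary by continuity of [u] on the closure. *)
move=> x bx [/= xrho hxd]; have [cx _] := bx.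
rewrite leNgt; apply/negP => uxT.
have [uc _ _] := uvisc.
pose D := closure Omega `*` [set t : R | 0 <= t].
have DxT : D (x, T) by split=> //; exact: ltW.
have : nbhs_subspace ((x, T) : subspace D) [set z | u z.1 z.2 < S / 4].
  exact: (uc (x, T) _ (lt_nbhsl uxT)).
rewrite -(nbhs_subspace_in DxT).
move=> [[V W] /= [Vx WT] VW].
have Ux : \forall y \near x, sqdist x0 y < rho ^+ 2 / 4 /\ h y < delta.
  by apply: filterI; [exact: sqdist_near|exact: (chart_near_lt chart)].
have [y [Oy [Vy [yrho hyd]]]] := cx _ (filterI Vx Ux).
have /(_ (y, T)) := VW; rewrite ltNge inside//= => H.
have : false; last by [].
apply: H; first by split=> //; exact: nbhs_singleton WT.
by split=> /=; [exact: subset_closure|exact: ltW].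
Qed.

End BoundaryBarrier.

(** * Compactness of the boundary and gluing of the local barriers *)

Section Domain.
Context {R : realType} {n : nat}.
Implicit Types (Omega : set 'rV[R]_n).

Lemma bounded_closure_compact Omega : bounded_set Omega ->
  compact (closure Omega).
Proof.
move=> [M [Mreal HM]]; apply: bounded_closed_compact;
  last exact: closed_closure.
exists (M + 1); split; first exact: num_real.
move=> K MK x cx; apply: le_trans (ltW MK).
have cl : closed [set y : 'rV[R]_n | `|y| <= M + 1].
  apply: (preimage_closed (f := fun y : 'rV[R]_n => `|y|)
    (D := [set y | y <= _])).
    by move=> y _; exact: norm_continuous.
  exact: closed_le.
by apply: cl; apply: closureS cx => y Oy; apply: HM => //; rewrite ltrDl.
Qed.

Lemma boundary_compact Omega : bounded_set Omega -> compact (boundary Omega).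
Proof.
move=> bO; have cO := bounded_closure_compact bO.
apply: subclosed_compact cO _; last by move=> x [].
rewrite /boundary setDE; apply: closedI; first exact: closed_closure.
exact/open_closedC/open_interior.
Qed.

Lemma C2_sum m (F : 'I_m -> 'rV[R]_n -> R) : (forall k, C2 (F k)) ->
  C2 (fun x => \sum_(k < m) F k x).
Proof. by move=> H; exact: C2_with_C2 (C2_with_sum (fun k => C2P (H k))). Qed.

Lemma C2_laplacian_bounded Omega (eta : 'rV[R]_n -> R) : C2 eta ->
  Omega !=set0 -> compact (closure Omega) ->
  exists C : R, 0 < C /\ forall x, closure Omega x -> `|laplacian eta x| < C.
Proof.
move=> [_ _ ddeta] [x Ox] cO.
have c : continuous (fun x => `|laplacian eta x|).
  apply: (continuous_comp1 (@norm_continuous _ _)); apply: continuous_bigsum.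
  by move=> k; have [] := ddeta k k.
have cO0 : closure Omega !=set0 by exists x; exact: subset_closure.
have [z _ Hz] := compact_EVT_max cO0 cO (continuous_subspaceT c).
exists (`|laplacian eta z| + 1); split; first by rewrite ltr_wpDl.
by move=> y cy; rewrite (le_lt_trans (Hz _ (mem_set cy)))// ltrDl.
Qed.

End Domain.

Unset Implicit Arguments.

Theorem theorem1 (R : realType) (n : nat) (alpha p : R) (Omega : set 'rV[R]_n)
  (n_gt0 : (0 < n)%N) (alpha_gt0 : 0 < alpha) (alpha_lt1 : alpha < 1)
  (p_gt2 : 2 < p)
  (Omega_dom : bounded_domain Omega) (Omega_reg : class_C2alpha alpha Omega) :
  exists u0 : 'rV[R]_n -> R,
    [/\ initial_data Omega u0,
        (forall u : 'rV[R]_n -> R -> R,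
           global_viscosity_solution Omega p u0 u ->
           loss_set Omega u = boundary Omega /\
           exists t0 c0 : R, [/\ 0 < t0, 0 < c0 &
             forall x, boundary Omega x -> c0 <= u x t0])
      & (forall v0 : 'rV[R]_n -> R,
           initial_data Omega v0 ->
           (forall x, closure Omega x -> u0 x <= v0 x) ->
           forall v : 'rV[R]_n -> R -> R,
             global_viscosity_solution Omega p v0 v ->
             loss_set Omega v = boundary Omega /\
             exists t0 c0 : R, [/\ 0 < t0, 0 < c0 &
               forall x, boundary Omega x -> c0 <= v x t0])].
Proof.
have [neO oO _ bO] := Omega_dom.
have cO := bounded_closure_compact bO.
(* A dummy pair off the boundary makes the statement total, as needed for [choice]. *)
have localP x0 : exists etaU : ('rV[R]_n -> R) * set 'rV[R]_n,
    boundary Omega x0 -> local_barrier Omega p x0 etaU.1 etaU.2.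
  have [bx0|nbx0] := pselect (boundary Omega x0); last first.
    by exists (fun=> 0, set0) => /nbx0.
  have [r [h [dh [ddh [i [r_gt0 chart]]]]]] :=
    boundary_chart_exists Omega_reg bx0.
  have [eta [U H]] := local_barrier_exists oO bx0 r_gt0 chart p_gt2.
  by exists (eta, U).
have [loc locP] := choice localP.
have := boundary_compact bO; rewrite compact_cover.
move=> /(_ _ (boundary Omega) (fun x => (loc x).2)) [x bx||].
- by have [_ _ _ [oU _] _] := locP _ bx.
- by move=> x bx; exists x => //; have [_ _ _ [_ Ux] _] := locP _ bx.
move=> D Dbd Dcover.
pose s := finmap.enum_fset D; pose m := size s; pose pt (k : 'I_m) := nth 0 s k.
have ptP k : local_barrier Omega p (pt k) (loc (pt k)).1 (loc (pt k)).2.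
  by apply: locP; exact: set_mem (Dbd (pt k) (mem_nth 0 (ltn_ord k))).
(* The summands are nonnegative, so the sum is at least 1 wherever one of them is. *)
pose eta x := \sum_(k < m) (loc (pt k)).1 x.
have etaC2 : C2 eta by apply: C2_sum => k; have [] := ptP k.
have eta_ge k x : (loc (pt k)).1 x <= eta x.
  rewrite /eta (bigD1 k)//= lerDl; apply: sumr_ge0 => j _.
  by have [] := ptP j.
have eta_bd x : boundary Omega x -> eta x = 0.
  by move=> bx; apply: big1 => k _; have [_ _ -> ] := ptP k.
have [C [C_gt0 lapC]] := C2_laplacian_bounded etaC2 neO cO.
(* Up to time [2 * T] one has [C * t <= 1 / 2], so [N * (eta x - C * t) >= N / 2] where
   [eta x >= 1]. *)
pose T := (4 * C)^-1; have T_gt0 : 0 < T by rewrite invr_gt0 mulr_gt0.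
have SP k : exists Sc : R * R, 0 < Sc.2 /\ barrier_conclusion Omega p
    (loc (pt k)).1 (loc (pt k)).2 T Sc.1 Sc.2.
  have [_ _ _ _ /(_ _ T_gt0)[S [c H]]] := ptP k.
  by exists (S, c).
have [Sc ScP] := choice SP.
(* Chosen so that N / 2 exceeds the requirement of every local barrier; the sign of these
   requirements is unknown, hence the absolute values. *)
pose N := 1 + \sum_(k < m) 2 * `|(Sc k).1|.
have sum_ge0 (P : pred 'I_m) : 0 <= \sum_(k < m | P k) 2 * `|(Sc k).1|.
  by apply: sumr_ge0 => k _; exact: mulr_ge0.
have N_gt0 : 0 < N by exact: ltr_pwDl ltr01 (sum_ge0 xpredT).
have NS k : 2 * (Sc k).1 <= N.
  rewrite /N (bigD1 k)//=; set X := \sum_(_ | _) _.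
  have X_ge0 : 0 <= X by exact: sum_ge0.
  by have := ler_norm (Sc k).1; lra.
(* The default 1 keeps the minimum positive whatever the size of the cover. *)
pose c0 := \big[Num.min/1]_(k < m) (Sc k).2.
have c0_gt0 : 0 < c0.
  by apply/bigmin_gtP; split=> // k _; have [] := ScP k.
have eta_ge0 x : 0 <= eta x by apply: sumr_ge0 => k _; have [] := ptP k.
have NetaC2 := C2_withZ N (C2P etaC2).
(* Only [N * eta <= v0] is used, so this covers both the datum [N * eta] itself and any larger one,
   with the same [T] and [c0]. *)
have main (v0 : 'rV[R]_n -> R) : initial_data Omega v0 ->
    (forall x, closure Omega x -> N * eta x <= v0 x) ->
    forall v, global_viscosity_solution Omega p v0 v ->
    loss_set Omega v = boundary Omega /\
    exists t0 c0 : R, [/\ 0 < t0, 0 < c0 &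
      forall x, boundary Omega x -> c0 <= v x t0].
  move=> [_ v0_ge0 _] v0_ge v vvisc.
  have bound x : boundary Omega x -> c0 <= v x T.
    move=> bx; have [y /= yD Uyx] := Dcover _ bx.
    have ky : (index y s < m)%N by rewrite index_mem.
    pose k := Ordinal ky; have ptk : pt k = y by rewrite /pt nth_index.
    have [_ Hk] := ScP k.
    apply: (le_trans (y := (Sc k).2)); first exact: bigmin_le.
    apply: (Hk v0 v vvisc) => //; last by rewrite ptk.
      exact: (viscosity_ge0 cO v0_ge0 vvisc).
    move=> z t cz /andP[t_ge0 t_le] etaz.
    have := viscosity_interior_bound oO cO v0_ge0 vvisc (C2P etaC2) eta_bd N_gt0
      lapC v0_ge cz t_ge0.
    apply: le_trans.
    have Ct : C * t <= 1 / 2.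
      have -> : 1 / 2 = C * (2 * T) by rewrite /T; field; rewrite gt_eqF.
      by rewrite ler_pM2l.
    apply: (le_trans (y := N * (1 / 2))); first by have := NS k; lra.
    by rewrite ler_pM2l//; have := le_trans etaz (eta_ge k z); lra.
  split; last by exists T, c0.
  apply/seteqP; split=> [x []//|x bx]; split=> //.
  by exists T; split=> //; exact: lt_le_trans (bound x bx).
have u0_data : initial_data Omega (fun x => N * eta x).
  have [c d cd _ _] := NetaC2; split.
  - split=> [|i]; first exact: continuous_subspaceT.
    exists (fun x => N * partial i eta x); split.
      exact: continuous_subspaceT (cd i).
    by move=> x _; have [] := d i x.
  - by move=> x _; rewrite mulr_ge0// ltW.
  - by move=> x bx; rewrite eta_bd// mulr0.
exists (fun x => N * eta x); split=> //.
by move=> u uvisc; exact: main u0_data _ u uvisc.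
Qed.
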